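(* Let $d\ge 3$ and fix $j\in\mathbb N$, $j\geq 1$. Then the random motions $\underline{\mathbf X}_d^{0,0,j}$, $\underline{\mathbf X}_d^{1,0,j}$, $\underline{\mathbf X}_d^{0,1,j}$, $\underline{\mathbf X}_d^{1,1,j}$ are identically distributed, in the sense that for every $t>0$ and every $n\ge 1$ the conditional distributions of the positions $\underline{\mathbf X}_d^{0,0,j}(t)$, $\underline{\mathbf X}_d^{1,0,j}(t)$, $\underline{\mathbf X}_d^{0,1,j}(t)$, $\underline{\mathbf X}_d^{1,1,j}(t)$ given $\mathcal N(t)=n$ coincide.
   Context: Setting. A particle starts at the origin of $\mathbb R^d$ and moves with constant speed $c>0$. $\mathcal N(t)$ is the number of changes of direction in $[0,t]$; given $\mathcal N(t)=n$, $n\ge1$, its position is $c\sum_{k=1}^{n+1}\underline{\mathbf V}_k\tau_k$, where $\tau_{n+1}=t-\sum_{k=1}^n\tau_k$, the directions $\underline{\mathbf V}_1,\dots,\underline{\mathbf V}_{n+1}$ are i.i.d. uniformly distributed on the unit sphere of $\mathbb R^d$, and the directions, $\underline\tau_n=(\tau_1,\dots,\tau_n)$ and $\mathcal N(t)$ are independent. Generalized Dirichlet law $GD(\underline{\mathbf a}_n;\underline{\mathbf b}_n)$, $\underline{\mathbf a}_n=(a_1,\dots,a_n)$, $\underline{\mathbf b}_n=(b_1,\dots,b_n)$: the probability distribution on the simplex $S_n=\{(\tau_1,\dots,\tau_n): \tau_k>0\ \forall k,\ \sum_{k=1}^n\tau_k<t\}$ with density proportional to $\prod_{k=1}^n\big[\tau_k^{a_k-1}(t-\sum_{l=1}^k\tau_l)^{b_k-1}\big]$.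 Definition of $\underline{\mathbf X}_d^{h,i,j}$, for $h,i\in\{0,1\}$, $j\geq1$, $d\ge3$: it is the motion above, in which, given $\mathcal N(t)=n$, $\underline\tau_n$ has law $GD(\underline{\mathbf a}_n;\underline{\mathbf b}_n)$ with the following parameters. (1) If $n\le j$: $\underline{\mathbf a}_n=(d-1,\dots,d-1)$ and $\underline{\mathbf b}_n=(1,\dots,1,d-1)$. (2) If $n>j$: $a_k=d-1$ for $k\in\{1,\dots,j\}$ and $a_k=\frac d2-1$ for $k\in\{j+1,\dots,n\}$; $b_k=1$ for $k\in\{1,\dots,n-1\}\setminus\{j\}$, $b_j=(n-j+1)\left(\frac d2-1\right)+i+h+1$, and $b_n=\frac d2-i$. *)

(* Defs.v *)
From HB Require Import structures.
From mathcomp Require Import all_boot all_order all_algebra.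
From mathcomp Require Import all_classical all_reals all_analysis.

Set Implicit Arguments.
Unset Strict Implicit.
Unset Printing Implicit Defensive.

Import Order.TTheory GRing.Theory Num.Theory.
Import numFieldNormedType.Exports.

Local Open Scope classical_set_scope.
Local Open Scope ring_scope.

(* R^n with its Borel sigma-algebra. The scalars are [measurableTypeR R], a
   type convertible to [R], because it is the carrier of [lebesgue_measure]. *)
Notation Rvec R n := (n.-tuple (measurableTypeR R)).

Section lebesgue_tuple.
Context {R : realType}.

Definition cons_pair n (p : measurableTypeR R * Rvec R n) :
  Rvec R n.+1 := [the n.+1.-tuple _ of p.1 :: p.2].

Lemma measurable_cons_pair n : measurable_fun setT (@cons_pair n).
Proof. exact: measurable_cons. Qed.

Section step.
Variables (n : nat)
  (mu : {sigma_finite_measure set (Rvec R n) -> \bar R}).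

Definition lebesgue_cons : set (Rvec R n.+1) -> \bar R :=
  pushforward (lebesgue_measure \x mu)%E (@cons_pair n).

Let cons0 : lebesgue_cons set0 = 0%E.
Proof. by rewrite /lebesgue_cons /pushforward preimage_set0 measure0. Qed.

Let cons_ge0 A : (0 <= lebesgue_cons A)%E.
Proof. exact: (@measure_ge0 _ _ _ (lebesgue_measure \x mu)%E). Qed.

Let cons_sigma_additive : semi_sigma_additive lebesgue_cons.
Proof.
move=> F mF tF mUF; rewrite /lebesgue_cons /pushforward preimage_bigcup.
apply: measure_semi_sigma_additive.
- by move=> k; rewrite -[X in measurable X]setTI; exact: measurable_cons_pair.
- move/trivIsetP : tF => tF; apply/trivIsetP => i k _ _ ik.
  by rewrite -preimage_setI tF// preimage_set0.
- rewrite -preimage_bigcup -[X in measurable X]setTI.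
  exact: measurable_cons_pair.
Qed.

HB.instance Definition _ :=
  isMeasure.Build _ _ _ lebesgue_cons cons0 cons_ge0 cons_sigma_additive.

Lemma lebesgue_cons_sigma_finite : sigma_finite setT lebesgue_cons.
Proof.
have /sigma_finiteP[F [FT ndF Foo]] := sigma_finiteT (@lebesgue_measure R).
have /sigma_finiteP[G [GT ndG Goo]] := sigma_finiteT mu.
pose uncons (s : Rvec R n.+1) : (measurableTypeR R * Rvec R n)%type :=
  (thead s, [tuple of behead s]).
have consK s : cons_pair (uncons s) = s by rewrite [RHS]tuple_eta.
have unconsK p : uncons (cons_pair p) = p.
  by case: p => x s; congr pair; apply/val_inj.
have muncons : measurable_fun setT uncons.
  apply/measurable_fun_pairP; split.
    exact: measurable_tnth.
  exact: measurable_behead.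
exists (fun k => uncons @^-1` (F k `*` G k)).
  rewrite -preimage_bigcup -[LHS](@preimage_setT _ _ uncons); congr preimage.
  apply/esym; rewrite -subTset => -[x y] _.
  have [i _ Fx] : (\bigcup_i F i) x by rewrite -FT.
  have [k _ Gy] : (\bigcup_i G i) y by rewrite -GT.
  exists (maxn i k) => //; split => /=.
  - by move: Fx; exact/subsetPset/ndF/leq_maxl.
  - by move: Gy; exact/subsetPset/ndG/leq_maxr.
move=> k; have [mF lF] := Foo k; have [mG lG] := Goo k; split.
  by rewrite -[X in measurable X]setTI; apply: muncons => //; exact: measurableX.
rewrite /lebesgue_cons /pushforward -comp_preimage.
rewrite (_ : uncons \o _ = id) ?preimage_id; last first.
  by apply/funext => p; exact: unconsK.
by rewrite product_measure1E// lte_mul_pinfty// ge0_fin_numE.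
Qed.

HB.instance Definition _ :=
  Measure_isSigmaFinite.Build _ _ _ lebesgue_cons lebesgue_cons_sigma_finite.

End step.

(* n-dimensional Lebesgue measure, as an iterated product measure. *)
Fixpoint lebesgue_tuple n :
    {sigma_finite_measure set (Rvec R n) -> \bar R} :=
  match n with
  | 0%N => \d_([tuple] : Rvec R 0)
  | m.+1 => lebesgue_cons (lebesgue_tuple m)
  end.

End lebesgue_tuple.


Section independence.
Local Open Scope ereal_scope.
Context {R : realType} {d0 : measure_display} {Omega : measurableType d0}
  (P : probability Omega R).

(* The events range over whole sigma-algebras, so taking some of them equal to
   [setT] yields the product rule for every subfamily. *)
Definition independent_family d1 (T : measurableType d1) m
    (Y : 'I_m -> Omega -> T) :=
  forall A : 'I_m -> set T, (forall k, measurable (A k)) ->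
    P (\bigcap_(k in [set: 'I_m]) (Y k @^-1` A k)) =
    \prod_(k < m) P (Y k @^-1` A k).

Definition independent3 d1 d2 d3 (T1 : measurableType d1)
    (T2 : measurableType d2) (T3 : measurableType d3)
    (Y1 : Omega -> T1) (Y2 : Omega -> T2) (Y3 : Omega -> T3) :=
  forall A1 A2 A3, measurable A1 -> measurable A2 -> measurable A3 ->
    P (Y1 @^-1` A1 `&` Y2 @^-1` A2 `&` Y3 @^-1` A3) =
    P (Y1 @^-1` A1) * P (Y2 @^-1` A2) * P (Y3 @^-1` A3).

(* Meaningful only when [P F] is positive. *)
Definition cond_prob (E F : set Omega) : \bar R :=
  (fine (P (E `&` F)) / fine (P F))%:E.

End independence.

Unset Implicit Arguments.

Section laws.
Context {R : realType}.

Definition unit_sphere (d : nat) : set (Rvec R d) :=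
  [set v | \sum_(i < d) (tnth v i : R) ^+ 2 = 1].

Definition mulmx_tuple {d : nat} (Q : 'M[R]_d) (v : Rvec R d) : Rvec R d :=
  [tuple \sum_(l < d) Q i l * (tnth v l : R) | i < d].

(* The uniform distribution on the unit sphere, i.e., the (unique) probability
   measure carried by the sphere and invariant under its isometries. *)
Definition uniform_on_sphere {d : nat} (mu : probability (Rvec R d) R) :=
  mu (unit_sphere d) = 1%E /\
  forall Q : 'M[R]_d, Q *m Q^T = 1%:M ->
  forall A : set (Rvec R d), measurable A ->
    mu (mulmx_tuple Q @^-1` A) = mu A.

Definition simplex (t : R) (n : nat) : set (Rvec R n) :=
  [set tau | (forall k : 'I_n, 0 < (tnth tau k : R)) /\
             \sum_(k < n) (tnth tau k : R) < t].

(* [a k] and [b k] are used for 1 <= k <= n only, whereas the coordinates of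
   [tau] are numbered from 0. *)
Definition GD_weight (t : R) {n : nat} (a b : nat -> R) (tau : Rvec R n) : R :=
  \prod_(k < n) ((tnth tau k : R) `^ (a k.+1 - 1) *
     (t - \sum_(l < n | (l <= k)%N) (tnth tau l : R)) `^ (b k.+1 - 1)).

Definition generalized_dirichlet (t : R) {n : nat} (a b : nat -> R)
    (mu : set (Rvec R n) -> \bar R) :=
  mu setT = 1%E /\
  exists K : R, forall A : set (Rvec R n), measurable A ->
    mu A = (K%:E * \int[lebesgue_tuple n]_(tau in A `&` simplex t n)
                     (GD_weight t a b tau)%:E)%E.

End laws.

Set Implicit Arguments.

(* [changes t] is the number of changes of direction in [0, t].
   [direction k] is the (k+1)-st direction. [duration t n] is the vector of the
   durations of the n first displacements used to describe the position at
   time t when n changes of direction have occurred: as its law is carried by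
   a simplex depending on t, it is a different vector for each t and n. *)
Record random_flight (R : realType) (d : nat) := RandomFlight {
  flight_display : measure_display;
  flight_space : measurableType flight_display;
  flight_prob : probability flight_space R;
  changes : R -> {RV flight_prob >-> nat};
  direction : nat -> {RV flight_prob >-> Rvec R d};
  duration : R -> forall n, {RV flight_prob >-> Rvec R n} }.

Unset Implicit Arguments.

Section flights.
Context {R : realType} {d : nat}.
Implicit Type X : random_flight R d.

Definition displacement (c t : R) {n : nat} (v : nat -> Rvec R d)
    (tau : Rvec R n) : Rvec R d :=
  [tuple c * (\sum_(k < n) (tnth (v k) i : R) * (tnth tau k : R) +
              (tnth (v n) i : R) * (t - \sum_(k < n) (tnth tau k : R)))
   | i < d].

Definition position (c : R) X (t : R) (w : flight_space X) : Rvec R d :=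
  displacement c t (fun k => direction X k w)
    (duration X t (changes X t w) w).

Definition directions X (n : nat) (w : flight_space X) :
  n.-tuple (Rvec R d) := [tuple direction X k w | k < n].

Definition changes_eq X (t : R) (n : nat) : set (flight_space X) :=
  changes X t @^-1` [set n].

Definition cond_duration_law X (t : R) (n : nat) : set (Rvec R n) -> \bar R :=
  fun B => cond_prob (flight_prob X) (duration X t n @^-1` B)
             (changes_eq X t n).

Definition cond_position_law (c : R) X (t : R) (n : nat) :
    set (Rvec R d) -> \bar R :=
  fun A => cond_prob (flight_prob X) (position c X t @^-1` A)
             (changes_eq X t n).

Definition uniform_flight X :=
  [/\ forall k, uniform_on_sphere
         (distribution (flight_prob X) (direction X k)),
      forall n, independent_family (flight_prob X)
         (fun k : 'I_n => direction X k) &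
      forall (t : R) (n : nat), 0 < t -> (1 <= n)%N ->
        independent3 (flight_prob X)
          (directions X n.+1) (duration X t n) (changes X t)].

Definition GD_a (j n k : nat) : R :=
  if ((n <= j) || (k <= j))%N then d%:R - 1 else d%:R / 2 - 1.

Definition GD_b (h i : bool) (j n k : nat) : R :=
  if (n <= j)%N then
    if k == n then d%:R - 1 else 1
  else if k == j then
    (n - j + 1)%N%:R * (d%:R / 2 - 1) + i%:R + h%:R + 1
  else if k == n then d%:R / 2 - i%:R else 1.

Definition GD_flight (h i : bool) (j : nat) X :=
  uniform_flight X /\
  forall (t : R) (n : nat), 0 < t -> (1 <= n)%N ->
    (0 < flight_prob X (changes_eq X t n))%E ->
    generalized_dirichlet t (GD_a j n) (GD_b h i j n)
      (cond_duration_law X t n).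

End flights.

(* Main.v *)
(* The law of a bounded random vector Z is determined by the moments of its
   projections <xi, Z>, so these are computed. A projection of a uniform point
   of the unit sphere of R^d has moments |xi|^p mu_p(d/2), where
   mu_2k(x) = (1/2)_k / (x)_k and the odd moments vanish. Integrating the
   generalized Dirichlet density one coordinate at a time, a segment with
   parameter a followed by a remaining flight with total parameter b amounts to
   multiplying the generating functions sum_p (a)_p mu_p z^p / p!. For
   (a, x) = (x - 1, x) and (x, x) these are, in terms of the Catalan series C,
   C^(x-1) and C^(x-1) / sqrt(1 - 4z) (up to the scaling of z), and for
   (2x - 1, x) and (2x, x) they are powers of 1 - z^2. Hence the last n - j + 1
   segments behave for i = 0 and i = 1 like one uniform direction in dimension
   (n - j + 1)(d - 2) + 2, the parameter b_j turns this into the exponents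
   2x - 1 (h = 0) or 2x (h = 1), and adding the j first segments yields the same
   moments for all h and i. *)

Require Import Defs.
From HB Require Import structures.
From mathcomp Require Import all_boot all_order all_algebra.
From mathcomp Require Import all_classical all_reals all_analysis.
From mathcomp Require Import measurable_realfun.
From mathcomp Require Import ring lra zify.

Set Implicit Arguments.
Unset Strict Implicit.
Unset Printing Implicit Defensive.

Import Order.TTheory GRing.Theory Num.Theory.
Import numFieldNormedType.Exports.

Local Open Scope classical_set_scope.
Local Open Scope ring_scope.

(** * Convolution identities *)

(** Integrating out one segment yields the Beta moments (a)_q (b)_(p-q) / (a+b)_p; hence the
    Pochhammer factor next to the moments in the series. Multiplying C^(x-1) by C^(y-1) or by
    C^(y-1) / sqrt(1 - 4z) preserves the shape of the second factor, with x + y - 1 as new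
    parameter, so both values of i give the same moments, with total parameters that differ by 1;
    the summand i of b_j undoes this difference. The densities are known only up to a factor. The
    total masses K t^e, which depend on h and i, are carried along without evaluation and eliminated
    at the end by the moment of order 0. Directions and durations lie in the sphere and in the
    simplex only almost surely; both are replaced by clamped versions, so that the displacement is
    bounded everywhere. Moments of projections give the mixed moments by polarization; explicit
    polynomials that converge boundedly to indicators of half-lines then lead to the measures of
    boxes. *)

Section rothe.
Variable F : numFieldType.
Implicit Types (P Q : nat -> {poly F}) (p : {poly F}).

(** A nonzero polynomial has fewer roots than its size. Besides the convolution identities, this
    serves below to compare coefficients of moments that depend polynomially on a parameter. *)
Lemma poly_nat_roots0 p : (forall n : nat, p.[n%:R] = 0) -> p = 0.
Proof.
move=> p0; apply/eqP; apply: contraT => pn0.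
have := @max_poly_roots _ p [seq n%:R | n <- iota 0 (size p)] pn0.
rewrite size_map size_iota ltnn; apply.
  by apply/allP => x /mapP[n _ ->]; rewrite /root p0.
rewrite map_inj_uniq ?iota_uniq// => m n /eqP.
by rewrite eqr_nat => /eqP.
Qed.

Lemma horner_XDC p (c x : F) : (p \Po ('X + c%:P)).[x] = p.[x + c].
Proof. by rewrite horner_comp hornerD hornerX hornerC. Qed.

(* Both sides of the Rothe-Hagen and Vandermonde identities are polynomial in
   [x], and by induction on [k] their difference is 1-periodic. *)
Lemma shift_family_conv (e : F) P Q :
  P 0%N = 1 -> (forall k, (P k.+1).[0] = 0) ->
  (forall k x, (P k.+1).[x + 1] = (P k.+1).[x] + (P k).[x + e]) ->
  Q 0%N = 1 ->
  (forall k x, (Q k.+1).[x + 1] = (Q k.+1).[x] + (Q k).[x + e]) ->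
  forall k x y,
    \sum_(i < k.+1) (P i).[x] * (Q (k - i)%N).[y] = (Q k).[x + y].
Proof.
move=> P0 P00 PS Q0 QS k x y.
elim: k x => [|k IH] x; first by rewrite big_ord_recl big_ord0 P0 Q0 !hornerC mulr1 addr0.
pose D := \sum_(i < k.+2) (P i) * ((Q (k.+1 - i)%N).[y])%:P - (Q k.+1 \Po ('X + y%:P)).
have DE z : D.[z] = \sum_(i < k.+2) (P i).[z] * (Q (k.+1 - i)%N).[y]
                    - (Q k.+1).[z + y].
  rewrite hornerD hornerN horner_XDC horner_sum; congr (_ - _).
  by apply: eq_bigr => i _; rewrite hornerM hornerC.
suff D0 : D = 0.
  by move: (DE x); rewrite D0 horner0 => /esym/eqP; rewrite subr_eq0 => /eqP.
apply: poly_nat_roots0; elim => [|n IHn].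
  rewrite DE big_ord_recl/= big1 ?P0 ?hornerC ?mul1r ?addr0 ?add0r ?subrr// => i _.
  by rewrite P00 mul0r.
(* By the shift rules, D(n+1) - D(n) is the difference of the two sides of the identity of order k
   at n + e, which vanishes by [IH]. *)
rewrite -natr1 -[RHS]IHn !DE !(big_ord_recl k.+1)/= P0 !hornerC.
under eq_bigr => i _ do rewrite /bump/= add1n subSS PS mulrDl.
rewrite big_split/= IH.
rewrite (_ : n%:R + 1 + y = n%:R + y + 1); last by ring.
rewrite QS (_ : n%:R + e + y = n%:R + y + e); last by ring.
under [in RHS]eq_bigr => i _ do rewrite /bump/= add1n subSS.
by ring.
Qed.

Definition poch (x : F) n := \prod_(i < n) (x + i%:R).

Lemma poch0 x : poch x 0 = 1. Proof. by rewrite /poch big_ord0. Qed.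

Lemma pochS x n : poch x n.+1 = poch x n * (x + n%:R).
Proof. by rewrite /poch big_ord_recr. Qed.

Lemma pochSl x n : poch x n.+1 = x * poch (x + 1) n.
Proof.
rewrite /poch big_ord_recl addr0; congr (_ * _); apply: eq_bigr => i _.
by rewrite /= /bump/= add1n -natr1; ring.
Qed.

Lemma pochD x m n : poch x (m + n)%N = poch x m * poch (x + m%:R) n.
Proof.
elim: n => [|n IH]; first by rewrite addn0 poch0 mulr1.
by rewrite addnS !pochS IH natrD; ring.
Qed.

Lemma poch_gt0 x n : 0 < x -> 0 < poch x n.
Proof. by move=> x0; apply: prodr_gt0 => i _; rewrite ltr_wpDr. Qed.

(** Legendre's duplication formula: even and odd factors are collected separately. *)
Lemma poch_double x n :
  poch (2 * x) (2 * n)%N = 4 ^+ n * poch x n * poch (x + 2^-1) n.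
Proof.
elim: n => [|n IH]; first by rewrite muln0 !poch0; ring.
rewrite mulnS !addSn add0n !pochS IH exprS -[((2 * n).+1)%:R]natr1 natrM.
by field.
Qed.

(** The duplication formula at x = 1/2, as (1)_n = n!. *)
Lemma poch_half_fact n :
  4 ^+ n * n`!%:R * poch 2^-1 n = ((2 * n)%N)`!%:R :> F.
Proof.
elim: n => [|n IH]; first by rewrite muln0 poch0 !fact0 !mulr1.
rewrite pochS mulnS !addSn add0n !factS !natrM -IH exprS -!natr1 natrM.
by field.
Qed.

Definition poly_poch (c : F) n : {poly F} := \prod_(i < n) ('X + (c + i%:R)%:P).

Lemma poly_pochE c n x : (poly_poch c n).[x] = poch (x + c) n.
Proof.
rewrite /poly_poch horner_prod; apply: eq_bigr => i _.
by rewrite hornerD hornerX hornerC addrA.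
Qed.

(* With C the generating function of the Catalan numbers, the values at [x] are
   the coefficients of C^x for [catalanA] and of C^x / sqrt(1 - 4z) for
   [catalanB]; those of [vandermonde] are the coefficients of (1 - z)^-x. *)
Definition catalanA k : {poly F} :=
  if k is k'.+1 then (k'.+1)`!%:R^-1 *: ('X * poly_poch (k'.+1 + 1)%:R k') else 1.

Definition catalanB k : {poly F} := (k`!%:R^-1) *: poly_poch (k + 1)%:R k.

Definition vandermonde k : {poly F} := (k`!%:R^-1) *: poly_poch 0 k.

Lemma factr_neq0 n : n`!%:R != 0 :> F.
Proof. by rewrite pnatr_eq0 -lt0n fact_gt0. Qed.

Lemma natrS_neq0 n : n%:R + 1 != 0 :> F.
Proof. by rewrite natr1 pnatr_eq0. Qed.

(** Coefficients of (1 - z)^-(x+1) = (1 - z)^-x + z (1 - z)^-(x+1). *)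
Lemma vandermonde_shift k x :
  (vandermonde k.+1).[x + 1] = (vandermonde k.+1).[x] + (vandermonde k).[x + 1].
Proof.
rewrite !hornerZ !poly_pochE !addr0 pochS pochSl factS natrM -natr1.
by field; rewrite factr_neq0 natrS_neq0.
Qed.

(** Coefficients of C^(x+1) = C^x + z C^(x+2), that is, of C = 1 + z C^2 times C^x, after
    multiplication by 1 / sqrt(1 - 4z). The same equation without this factor gives the rule for
    [catalanA]. *)
Lemma catalanB_shift k x :
  (catalanB k.+1).[x + 1] = (catalanB k.+1).[x] + (catalanB k).[x + 2].
Proof.
rewrite !hornerZ !poly_pochE.
rewrite [poch (x + _) k.+1]pochSl [poch (x + 1 + _) _]pochS.
have -> : x + 1 + (k.+1 + 1)%:R = x + k%:R + 3 by rewrite !natrD -natr1; ring.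
have -> : x + (k.+1 + 1)%:R + 1 = x + k%:R + 3 by rewrite !natrD -natr1; ring.
have -> : x + 2 + (k + 1)%:R = x + k%:R + 3 by rewrite !natrD; ring.
rewrite factS natrM natrD -natr1.
by field; rewrite factr_neq0 natrS_neq0.
Qed.

Lemma catalanA_shift k x :
  (catalanA k.+1).[x + 1] = (catalanA k.+1).[x] + (catalanA k).[x + 2].
Proof.
case: k => [|k]; rewrite /= !hornerZ !hornerM !hornerX !poly_pochE.
  by rewrite !poch0 hornerC (_ : 1`! = 1%N)//; field.
rewrite [poch (x + _) k.+1]pochSl [poch (x + 1 + _) _]pochS.
have -> : x + 1 + (k.+2 + 1)%:R = x + k%:R + 4 by rewrite !natrD -!natr1; ring.
have -> : x + (k.+2 + 1)%:R + 1 = x + k%:R + 4 by rewrite !natrD -!natr1; ring.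
have -> : x + 2 + (k.+1 + 1)%:R = x + k%:R + 4 by rewrite !natrD -natr1; ring.
rewrite [k.+2`!]factS natrM natrD -!natr1.
by field; rewrite factr_neq0 natr1 natrS_neq0.
Qed.

Lemma rothe_hagenA k x y :
  \sum_(i < k.+1) (catalanA i).[x] * (catalanA (k - i)%N).[y] = (catalanA k).[x + y].
Proof.
apply: (@shift_family_conv 2) => //; try exact: catalanA_shift.
by move=> i; rewrite hornerZ hornerM hornerX mul0r mulr0.
Qed.

Lemma rothe_hagenB k x y :
  \sum_(i < k.+1) (catalanA i).[x] * (catalanB (k - i)%N).[y] = (catalanB k).[x + y].
Proof.
apply: (@shift_family_conv 2) => //; try exact: catalanA_shift; try exact: catalanB_shift.
- by move=> i; rewrite hornerZ hornerM hornerX mul0r mulr0.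
- by rewrite /catalanB /poly_poch big_ord0 fact0 invr1 scale1r.
Qed.

Lemma vandermonde_conv k x y :
  \sum_(i < k.+1) (vandermonde i).[x] * (vandermonde (k - i)%N).[y] = (vandermonde k).[x + y].
Proof.
have v0 : vandermonde 0 = 1.
  by rewrite /vandermonde /poly_poch big_ord0 fact0 invr1 scale1r.
apply: (@shift_family_conv 1) => //; try exact: vandermonde_shift.
by move=> i; rewrite hornerZ poly_pochE add0r pochSl mul0r mulr0.
Qed.

End rothe.

(** * Moments of uniform directions under Beta mixing *)

Section moment_convolution.
Variable F : numFieldType.

(* The moments of a coordinate of a uniform point of the unit sphere of R^(2x). *)
Definition sphere_moment (x : F) p : F :=
  if odd p then 0 else poch 2^-1 p./2 / poch x p./2.

Definition moment_coef (a x : F) p := poch a p * sphere_moment x p / p`!%:R.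

Lemma moment_coef_odd a x p : odd p -> moment_coef a x p = 0.
Proof. by rewrite /moment_coef /sphere_moment => ->; rewrite mulr0 mul0r. Qed.

Lemma moment_coef_double a x k : 0 < x ->
  moment_coef a x (2 * k)%N = poch a (2 * k)%N / (4 ^+ k * k`!%:R * poch x k).
Proof.
move=> x0; rewrite /moment_coef /sphere_moment oddM/= -poch_half_fact.
rewrite mul2n doubleK; field.
by rewrite !gt_eqF ?poch_gt0 ?factr_neq0// ?exprn_gt0// ?invr_gt0// ltr0n fact_gt0.
Qed.

(** For k > 0, (x-1)_(2k) = (x-1) (x)_k (x+k)_(k-1), and (x)_k cancels the denominator of the
    moment. The factor 4^-k means that C is evaluated at z^2 / 4. *)
Lemma moment_coef_A x k : 0 < x ->
  moment_coef (x - 1) x (2 * k)%N = 4 ^- k * (catalanA F k).[x - 1].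
Proof.
move=> x0; rewrite moment_coef_double//.
case: k => [|k]; first by rewrite muln0 !poch0 expr0 fact0 hornerC; field.
rewrite mulnS !addSn pochSl add0n subrK.
rewrite (_ : (2 * k).+1 = (k.+1 + k)%N); last by lia.
rewrite pochD /= hornerZ hornerM hornerX poly_pochE.
have -> : x - 1 + (k.+1 + 1)%:R = x + k.+1%:R by rewrite natrD; ring.
field.
by rewrite factr_neq0 !gt_eqF ?poch_gt0// ?exprn_gt0.
Qed.

Lemma moment_coef_B x k : 0 < x ->
  moment_coef x x (2 * k)%N = 4 ^- k * (catalanB F k).[x - 1].
Proof.
move=> x0; rewrite moment_coef_double// mul2n -addnn pochD hornerZ poly_pochE.
have -> : x - 1 + (k + 1)%:R = x + k%:R by rewrite natrD; ring.
field.
by rewrite factr_neq0 !gt_eqF ?poch_gt0// ?exprn_gt0.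
Qed.

(** By duplication, (2x-1)_(2k) = 4^k (x-1/2)_k (x)_k; what remains after cancellation is the series
    (1 - z^2)^-(x-1/2). With 2x instead of 2x - 1 the exponent becomes -(x+1/2). *)
Lemma moment_coef_V1 x k : 0 < x ->
  moment_coef (2 * x - 1) x (2 * k)%N = (vandermonde F k).[x - 2^-1].
Proof.
move=> x0; rewrite moment_coef_double// hornerZ poly_pochE addr0.
rewrite (_ : 2 * x - 1 = 2 * (x - 2^-1)); last by field.
rewrite poch_double subrK; field.
by rewrite factr_neq0 !gt_eqF ?poch_gt0// ?exprn_gt0.
Qed.

Lemma moment_coef_V2 x k : 0 < x ->
  moment_coef (2 * x) x (2 * k)%N = (vandermonde F k).[x + 2^-1].
Proof.
move=> x0; rewrite moment_coef_double// hornerZ poly_pochE addr0.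
rewrite poch_double; field.
by rewrite factr_neq0 !gt_eqF ?poch_gt0// ?exprn_gt0.
Qed.

(* If W and W' have the moments of parameters [x] and [y], and U has the
   Beta(a, b) law, all independent, then U W + (1 - U) W' has the moments of
   parameter [z]. *)
Definition moment_conv (a x b y z : F) := forall p,
  \sum_(q < p.+1) 'C(p, q)%:R * (sphere_moment x q * poch a q)
     * (sphere_moment y (p - q) * poch b (p - q)) =
  poch (a + b) p * sphere_moment z p.

Lemma big_nat_even (f g : nat -> F) n : (forall i, odd i -> f i = 0) ->
    (forall i, (i <= n)%N -> f (2 * i)%N = g i) ->
  \sum_(0 <= i < (2 * n + 1)%N) f i = \sum_(0 <= i < n.+1) g i.
Proof.
move=> f0; elim: n => [|n IH] fg; first by rewrite muln0 add0n !big_nat1 -fg.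
rewrite (_ : (2 * n.+1 + 1)%N = (2 * n + 1).+2); last by lia.
rewrite big_nat_recr//= big_nat_recr//= IH; last by move=> i ilt; apply: fg; lia.
rewrite [in RHS]big_nat_recr//= (f0 (_ + _)%N) ?addr0; last by lia.
by rewrite -fg//; congr (_ + f _); lia.
Qed.

(** Division by p! turns the binomial convolution into a product of power series, and only pairs of
    even indices contribute. *)
Lemma moment_convP a x b y z :
  (forall k, \sum_(i < k.+1) moment_coef a x (2 * i)%N * moment_coef b y (2 * (k - i))%N
     = moment_coef (a + b) z (2 * k)%N) ->
  moment_conv a x b y z.
Proof.
move=> H p.
transitivity (p`!%:R * \sum_(q < p.+1) moment_coef a x q * moment_coef b y (p - q)).
  rewrite big_distrr/=; apply: eq_bigr => q _; rewrite /moment_coef.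
  rewrite -(@bin_fact p q) ?leq_ord// !natrM.
  by field; rewrite !factr_neq0.
transitivity (p`!%:R * moment_coef (a + b) z p); last first.
  by rewrite /moment_coef; field; rewrite factr_neq0.
congr (_ * _).
have [op|ep] := boolP (odd p).
  rewrite moment_coef_odd// big1// => q _.
  have [oq|eq_] := boolP (odd q); first by rewrite moment_coef_odd// mul0r.
  rewrite [X in _ * X]moment_coef_odd ?mulr0//.
  by rewrite oddB ?leq_ord// op (negbTE eq_).
have -> : p = (2 * p./2)%N by lia.
rewrite -H; move: (p./2) => k {ep p}.
rewrite -(big_mkord xpredT (fun q => moment_coef a x q * moment_coef b y (2 * k - q)%N)).
rewrite -(big_mkord xpredT (fun i => moment_coef a x (2 * i)%N * moment_coef b y (2 * (k - i))%N)).
rewrite (_ : (2 * k).+1 = (2 * k + 1)%N); last by lia.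
rewrite (big_nat_even (g := fun i => moment_coef a x (2 * i)%N * moment_coef b y (2 * (k - i))%N))//.
- by move=> i oi; rewrite moment_coef_odd// mul0r.
- by move=> i ik; rewrite mulnBr.
Qed.

Lemma moment_conv_catalanA x y : 0 < x -> 0 < y -> 0 < x + y - 1 ->
  moment_conv (x - 1) x (y - 1) y (x + y - 1).
Proof.
move=> x0 y0 z0; apply: moment_convP => k.
rewrite (_ : x - 1 + (y - 1) = x + y - 1 - 1); last by ring.
rewrite moment_coef_A// (_ : x + y - 1 - 1 = x - 1 + (y - 1)); last by ring.
rewrite -rothe_hagenA big_distrr; apply: eq_bigr => i _ /=.
rewrite !moment_coef_A//.
have -> : 4 ^- k = 4 ^- i * 4 ^- (k - i) :> F.
  by rewrite -invfM -exprD subnKC// leq_ord.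
by ring.
Qed.

(** The third parameter is x + y - 1, as in [moment_conv_catalanA], although the total parameter of
    the second factor is y instead of y - 1: this is why i does not affect the moments. *)
Lemma moment_conv_catalanB x y : 0 < x -> 0 < y -> 0 < x + y - 1 ->
  moment_conv (x - 1) x y y (x + y - 1).
Proof.
move=> x0 y0 z0; apply: moment_convP => k.
rewrite (_ : x - 1 + y = x + y - 1); last by ring.
rewrite moment_coef_B// (_ : x + y - 1 - 1 = x - 1 + (y - 1)); last by ring.
rewrite -rothe_hagenB big_distrr; apply: eq_bigr => i _ /=.
rewrite moment_coef_A// moment_coef_B//.
have -> : 4 ^- k = 4 ^- i * 4 ^- (k - i) :> F.
  by rewrite -invfM -exprD subnKC// leq_ord.
by ring.
Qed.

Lemma moment_conv_vandermonde1 x y : 0 < x -> 0 < y -> 0 < x + y - 2^-1 ->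
  moment_conv (2 * x - 1) x (2 * y - 1) y (x + y - 2^-1).
Proof.
move=> x0 y0 z0; apply: moment_convP => k.
rewrite (_ : 2 * x - 1 + (2 * y - 1) = 2 * (x + y - 2^-1) - 1); last by field.
rewrite moment_coef_V1//.
rewrite (_ : x + y - 2^-1 - 2^-1 = (x - 2^-1) + (y - 2^-1)); last by ring.
rewrite -vandermonde_conv; apply: eq_bigr => i _ /=.
by rewrite !moment_coef_V1.
Qed.

(** Again the third parameter agrees with that of the preceding lemma, because (x - 1/2) + (y + 1/2)
    = (x + y - 1/2) + 1/2; this makes h irrelevant to the moments. *)
Lemma moment_conv_vandermonde2 x y : 0 < x -> 0 < y -> 0 < x + y - 2^-1 ->
  moment_conv (2 * x - 1) x (2 * y) y (x + y - 2^-1).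
Proof.
move=> x0 y0 z0; apply: moment_convP => k.
rewrite (_ : 2 * x - 1 + 2 * y = 2 * (x + y - 2^-1)); last by field.
rewrite moment_coef_V2//.
rewrite (_ : x + y - 2^-1 + 2^-1 = (x - 2^-1) + (y + 2^-1)); last by ring.
rewrite -vandermonde_conv; apply: eq_bigr => i _ /=.
by rewrite moment_coef_V1// moment_coef_V2.
Qed.

End moment_convolution.

(** * The Beta integral with real parameters *)

Section beta_integral.
Context {R : realType}.
Notation mu := (@lebesgue_measure R).
Implicit Types (a b t u x y : R).


(** Lebesgue measure equals t times its image under x -> a + t x, since both agree on half-open
    intervals. This yields the substitution for every nonnegative measurable f. *)
Lemma ge0_integral_affine (a t : R) (f : R -> \bar R) :
  0 < t -> measurable_fun setT f -> (forall x, (0 <= f x)%E) ->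
  (\int[mu]_x f x = t%:E * \int[mu]_x f (a + t * x)%R)%E.
Proof.
move=> t0 mf f0.
pose phi (x : measurableTypeR R) : measurableTypeR R := a + t * x.
have mphi : measurable_fun setT phi.
  by apply: measurable_funD => //; apply: measurable_funM.
pose pm : {measure set (measurableTypeR R) -> \bar R} :=
  measure_function_pushforward__canonical__measure_function_Measure mu mphi.
pose mm := mscale (NngNum (ltW t0)) pm.
have muE A : measurable A -> mu A = mm A.
  apply: lebesgue_measure_unique => _ [[p q] _ <-]/=.
  rewrite /mm /mscale/= /pushforward.
  rewrite (_ : phi @^-1` _ = `](p - a) / t, (q - a) / t]%classic); last first.
    apply/seteqP; split => x /=; rewrite !in_itv/= /phi ltr_pdivrMr// ler_pdivlMr//.
      by rewrite ltrBlDl lerBrDl [x * t]mulrC.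
    by rewrite ltrBlDl lerBrDl [x * t]mulrC.
  rewrite !lebesgue_measure_itv/= !lte_fin ltr_pM2r ?invr_gt0// ltrD2r.
  case: ifP => // _; last by rewrite mule0.
  by rewrite -!EFinB -EFinM; congr EFin; field; rewrite gt_eqF.
rewrite (eq_measure_integral mm); last by move=> A mA _; exact: muE.
rewrite /mm ge0_integral_mscale//; congr (_ * _)%E.
by rewrite ge0_integral_pushforward.
Qed.

Lemma ge0_integral_itv_affine (a t : R) (f : R -> \bar R) :
  0 < t -> measurable_fun setT f -> (forall x, (0 <= f x)%E) ->
  (\int[mu]_(x in `]a, (a + t)%R[) f x =
   t%:E * \int[mu]_(x in `]0%R, 1%R[) f (a + t * x)%R)%E.
Proof.
move=> t0 mf f0; rewrite integral_mkcond (ge0_integral_affine a t0); last 2 first.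
- by apply/(measurable_restrictT _ _).1 => //; exact: measurable_funTS.
- by move=> u; apply: erestrict_ge0.
congr (_ * _)%E; rewrite [RHS]integral_mkcond; apply: eq_integral => x _.
rewrite !patchE; congr (if _ then _ else _).
apply/idP/idP; rewrite !inE/= !in_itv/= ltrDl ltrD2l.
  by rewrite pmulr_rgt0// gtr_pMr.
by rewrite pmulr_rgt0// gtr_pMr.
Qed.

(** For y < 1 the integrand is unbounded near 0, so the fundamental theorem of calculus is applied
    on [e, 1] only and e tends to 0 by monotone convergence. *)
Lemma integral_powR (y : R) : 0 < y ->
  (\int[mu]_(x in `]0%R, 1%R[) (x `^ (y - 1))%:E)%E = (y^-1)%:E.
Proof.
move=> y0.
have FTC (e : R) : 0 < e < 1 ->
  (\int[mu]_(x in `[e, 1%R]) (x `^ (y - 1))%:E)%E = (y^-1 - y^-1 * e `^ y)%:E.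
  move=> /andP[e0 e1].
  have cp (z c : R) : 0 < c -> {for c, continuous (fun x : R => x `^ z)}.
    move=> c0; apply: differentiable_continuous; apply/derivable1_diffP.
    by apply: derivable_powR; rewrite in_itv/= andbT.
  rewrite (@continuous_FTC2 _ _ (fun x => y^-1 * x `^ y))//.
  - by rewrite powR1 mulr1 EFinB.
  - apply: continuous_in_subspaceT => x; rewrite inE/= in_itv/= => /andP[ex _].
    by apply: cp; exact: lt_le_trans ex.
  - split.
    + move=> x; rewrite in_itv/= => /andP[ex _]; apply: derivableM => //.
      by apply: derivable_powR; rewrite in_itv/= andbT; exact: lt_trans ex.
    + apply: cvgM; first exact: cvg_cst.
      by apply: cvg_at_right_filter; exact: cp.
    + apply: cvgM; first exact: cvg_cst.
      by apply: cvg_at_left_filter; exact: cp.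
  - move=> x; rewrite in_itv/= => /andP[ex _].
    have x0 : 0 < x by exact: lt_trans ex.
    rewrite derive1E deriveZ/=; last first.
      by apply: derivable_powR; rewrite in_itv/= andbT.
    by have [_ ->] := is_derive1_powR y x0; rewrite /GRing.scale/= mulrA mulVf ?mul1r ?gt_eqF.
rewrite integral_itv_bndo_bndc; last first.
  by apply/measurable_EFinP; apply: measurable_funTS.
(* The shift by 2 keeps the left endpoint strictly below 1, as [FTC] demands. *)
pose F n : set R := `[n.+2%:R^-1, 1%R]%classic.
have -> : `]0%R, 1%R]%classic = \bigcup_n F n.
  apply/seteqP; split => x /=.
    rewrite ?in_itv/= => /andP[x0 x1].
    have [n _ nx] := near_infty_natSinv_lt (PosNum x0).
    exists n.+1 => //=; rewrite /F/= ?in_itv/= x1 andbT ltW//.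
    by apply: lt_trans (nx n.+1 _) => //=; rewrite ltf_pV2 ?posrE// ltr_nat.
  by move=> [n _]; rewrite /F/= ?in_itv/= => /andP[nx ->]; rewrite andbT (lt_le_trans _ nx).
have cv : (\int[mu]_(x in F n) (x `^ (y - 1))%:E)%E @[n --> \oo] -->
    (\int[mu]_(x in \bigcup_n F n) (x `^ (y - 1))%:E)%E.
  apply: ge0_nondecreasing_set_cvg_integral => //.
  - move=> m n mn; apply/subsetPset => x /=; rewrite /F/= ?in_itv/= => /andP[mx ->].
    by rewrite andbT (le_trans _ mx)// lef_pV2 ?posrE// ler_nat !ltnS.
  - by move=> i; exact: measurable_itv.
  - by move=> i; apply/measurable_EFinP; apply: measurable_funTS.
  - by move=> i x _; rewrite lee_fin powR_ge0.
apply: (cvg_unique _ cv) => //.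
rewrite (_ : (fun i => _) = (fun n => (y^-1 - y^-1 * (n.+2%:R^-1) `^ y)%:E)); last first.
  by apply/funext => n; rewrite FTC// invr_gt0 ltr0n invf_lt1 ?ltr1n.
apply: cvg_EFin; first exact: nearW.
rewrite -[X in _ --> X]subr0 -[X in _ - X](mulr0 y^-1).
apply: cvgB; first exact: cvg_cst.
apply: cvgM; first exact: cvg_cst.
have h : (fun n => n.+2%:R^-1 : R) @ \oo --> 0^'+.
  move=> A [/= e e0 Ae]; have [n _ ne] := near_infty_natSinv_lt (PosNum e0).
  exists n => // m nm /=; apply: Ae => /=; last by rewrite invr_gt0.
  rewrite sub0r normrN ger0_norm ?invr_ge0//.
  by apply: lt_trans (ne m _) => //=; rewrite ltf_pV2 ?posrE// ltr_nat.
exact: (cvg_comp _ _ h (powR_cvg0 y0)).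
Qed.

(** Kept in the extended reals because its finiteness is a consequence of the Fubini identity
    below. *)
Definition beta_integral (x y : R) : \bar R :=
  (\int[mu]_(u in `]0%R, 1%R[) (u `^ (x - 1) * (1 - u) `^ (y - 1))%:E)%E.

Lemma measurable_beta_kernel (x y t : R) (D : set R) :
  measurable_fun D (fun u : R => u `^ (x - 1) * (t - u) `^ (y - 1)).
Proof.
apply: measurable_funTS; apply: measurable_funM => //.
by apply: (measurableT_comp (f := @powR R ^~ (y - 1))) => //; exact: measurable_funB.
Qed.

Lemma beta_integral_ge0 x y : (0 <= beta_integral x y)%E.
Proof. by apply: integral_ge0 => u _; rewrite lee_fin mulr_ge0// powR_ge0. Qed.

Lemma beta_integral_scale x y t : 0 < t ->
  (\int[mu]_(u in `]0%R, t[) (u `^ (x - 1) * (t - u) `^ (y - 1))%:E =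
   (t `^ (x + y - 1))%:E * beta_integral x y)%E.
Proof.
move=> t0.
have := @ge0_integral_itv_affine 0 t (fun u => (u `^ (x - 1) * (t - u) `^ (y - 1))%:E) t0.
rewrite add0r => ->; last 2 first.
- by apply/measurable_EFinP; exact: measurable_beta_kernel.
- by move=> u; rewrite lee_fin mulr_ge0// powR_ge0.
rewrite /beta_integral -[RHS]ge0_integralZl//; last 3 first.
- by apply/measurable_EFinP; exact: measurable_beta_kernel.
- by move=> u _; rewrite lee_fin mulr_ge0// powR_ge0.
- by rewrite lee_fin powR_ge0.
rewrite -[LHS]ge0_integralZl; last 4 first.
- exact: measurable_itv.
- apply/measurable_EFinP; apply: measurable_funTS.
  apply: (measurableT_comp (f := fun u => u `^ (x - 1) * (t - u) `^ (y - 1))) => //.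
    exact: measurable_beta_kernel.
  by apply: measurable_funD => //; exact: measurable_funM.
- by move=> u _; rewrite lee_fin mulr_ge0// powR_ge0.
- by rewrite lee_fin ltW.
apply: eq_integral => u; rewrite inE/= in_itv/= => /andP[u0 u1].
rewrite -!EFinM add0r (_ : t - t * u = t * (1 - u)); last by ring.
rewrite !powRM ?subr_ge0 ?(ltW u0) ?(ltW u1) ?(ltW t0)//; congr EFin.
rewrite (_ : x + y - 1 = (x - 1) + (y - 1) + 1); last by ring.
have tn0 : t != 0 by rewrite gt_eqF.
rewrite [t `^ (_ + _ + 1)]powRD ?tn0 ?implybT// [t `^ (_ + (y - 1))]powRD ?tn0 ?implybT//.
by rewrite powRr1 ?ltW//; ring.
Qed.

Lemma integral_powR_itv (u s y : R) : 0 < y -> u < s ->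
  (\int[mu]_(t in `]u, s[) ((t - u) `^ (y - 1))%:E = ((s - u) `^ y / y)%:E)%E.
Proof.
move=> y0 us; have su0 : 0 < s - u by rewrite subr_gt0.
have mp : measurable_fun setT (fun t : R => (t - u) `^ (y - 1)).
  by apply: (measurableT_comp (f := @powR R ^~ (y - 1))) => //; exact: measurable_funB.
have := @ge0_integral_itv_affine u (s - u) (fun t => ((t - u) `^ (y - 1))%:E) su0.
rewrite subrKC => ->; last 2 first.
- exact/measurable_EFinP.
- by move=> t; rewrite lee_fin powR_ge0.
transitivity ((s - u)%:E * ((s - u) `^ (y - 1))%:E *
    \int[mu]_(x in `]0%R, 1%R[) (x `^ (y - 1))%:E)%E; last first.
  rewrite integral_powR// -!EFinM; congr EFin.
  by rewrite mulr_powRB1// ltW.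
rewrite -muleA; congr (_ * _)%E.
rewrite -ge0_integralZl//; last 3 first.
- by apply/measurable_EFinP; apply: measurable_funTS.
- by move=> t _; rewrite lee_fin powR_ge0.
- by rewrite lee_fin powR_ge0.
apply: eq_integral => t; rewrite inE/= in_itv/= => /andP[t0 t1].
by rewrite -EFinM [u + _]addrC addrK powRM// ltW.
Qed.

(* Integrate [u^(x-1) (t-u)^(y-1)] over [0 < u < t < 1] in both orders. *)
Lemma beta_integral_fubini x y : 0 < x -> 0 < y ->
  (((x + y)^-1)%:E * beta_integral x y = (y^-1)%:E * beta_integral x (y + 1))%E.
Proof.
move=> x0 y0.
(* The components of p are t and u; the triangle is encoded by 0-1 factors so that f is measurable
   on the whole plane. *)
pose f (p : measurableTypeR R * measurableTypeR R) : \bar R :=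
  ((p.2 `^ (x - 1) * (p.1 - p.2) `^ (y - 1)) *
   (0 < p.2)%R%:R * (p.2 < p.1)%R%:R * (p.1 < 1)%R%:R)%:E.
have f0 p : (0 <= f p)%E.
  by rewrite lee_fin !mulr_ge0// powR_ge0.
have mf : measurable_fun setT f.
  apply/measurable_EFinP.
  have mlt (g h : measurableTypeR R * measurableTypeR R -> R) : measurable_fun setT g ->
      measurable_fun setT h -> measurable_fun setT (fun p => (g p < h p)%R%:R : R).
    move=> mg mh; apply: (measurableT_comp (f := fun b : bool => b%:R : R)) => //.
    exact: measurable_fun_ltr.
  apply: measurable_funM; last by apply: mlt.
  apply: measurable_funM; last by apply: mlt.
  apply: measurable_funM; last by apply: mlt.
  apply: measurable_funM.
    by apply: (measurableT_comp (f := @powR R ^~ (x - 1))).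
  apply: (measurableT_comp (f := @powR R ^~ (y - 1))) => //.
  exact: measurable_funB.
have := @fubini_tonelli _ _ _ _ _ mu mu f mf f0.
have -> : (\int[mu]_t \int[mu]_u f (t, u) =
    \int[mu]_(t in `]0%R, 1%R[) ((t `^ (x + y - 1))%:E * beta_integral x y))%E.
  rewrite [RHS]integral_mkcond; apply: eq_integral => t _; rewrite patchE.
  case: ifPn => [|tN].
    rewrite inE/= in_itv/= => /andP[t0 t1]; rewrite -beta_integral_scale//.
    rewrite [RHS]integral_mkcond; apply: eq_integral => u _; rewrite patchE /f/= t1 mulr1.
    case: ifPn => [|uN]; first by rewrite inE/= in_itv/= => /andP[-> ->]; rewrite !mulr1.
    case: (ltP 0 u) uN => /= u0; last by rewrite mulr0 mul0r.
    by rewrite notin_setE/= in_itv/= u0/=; case: ltP => // _ _; rewrite mulr0.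
  apply: integral0_eq => u _; rewrite /f/=; congr EFin.
  move: tN; rewrite notin_setE/= in_itv/=; case: ltP => [t0|t0 _]/=; last first.
    case: (ltP 0 u) => u0; last by rewrite mulr0 !mul0r.
    by rewrite (ltNge u) (le_trans t0 (ltW u0)) !mulr0 mul0r.
  by case: ltP => //= _ _; rewrite mulr0.
have -> : (\int[mu]_u \int[mu]_t f (t, u) =
    \int[mu]_(u in `]0%R, 1%R[) ((y^-1)%:E * (u `^ (x - 1) * (1 - u) `^ (y + 1 - 1))%:E))%E.
  rewrite [RHS]integral_mkcond; apply: eq_integral => u _; rewrite patchE.
  case: ifPn => [|uN].
    rewrite inE/= in_itv/= => /andP[u0 u1].
    rewrite addrK -EFinM mulrC -mulrA EFinM -integral_powR_itv//.
    rewrite -ge0_integralZl//; last 3 first.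
    - apply/measurable_EFinP; apply: measurable_funTS.
      by apply: (measurableT_comp (f := @powR R ^~ (y - 1))) => //; exact: measurable_funB.
    - by move=> t _; rewrite lee_fin powR_ge0.
    - by rewrite lee_fin powR_ge0.
    rewrite [RHS]integral_mkcond; apply: eq_integral => t _; rewrite patchE /f/= u0 mulr1.
    case: ifPn => [|tN]; first by rewrite inE/= in_itv/= => /andP[-> ->]; rewrite !mulr1.
    move: tN; rewrite notin_setE/= in_itv/=; case: ltP => /= ut; last by rewrite mulr0 mul0r.
    by case: ltP => // _ _; rewrite mulr0.
  apply: integral0_eq => t _; rewrite /f/=; congr EFin.
  move: uN; rewrite notin_setE/= in_itv/=; case: ltP => [u0|u0 _]/=; last by rewrite mulr0 !mul0r.
  case: ltP => //= u1 _; case: (ltP u t) => ut; last by rewrite mulr0 mul0r.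
  by rewrite (ltNge t) (le_trans u1 (ltW ut)) mulr0.
rewrite ge0_integralZr; last 4 first.
- exact: measurable_itv.
- by apply/measurable_EFinP; apply: measurable_funTS.
- by move=> t _; rewrite lee_fin powR_ge0.
- exact: beta_integral_ge0.
rewrite integral_powR; last exact: addr_gt0.
move=> ->.
rewrite ge0_integralZl//.
- by apply/measurable_EFinP; exact: measurable_beta_kernel.
- by move=> t _; rewrite lee_fin mulr_ge0// powR_ge0.
- by rewrite lee_fin invr_ge0 ltW.
Qed.

(** Since (1-u)^y <= 1, the integral with second parameter y + 1 is at most 1/x; the Fubini identity
    carries finiteness down to y, where the exponent y - 1 may be negative. *)
Lemma beta_integral_fin x y : 0 < x -> 0 < y -> beta_integral x y \is a fin_num.
Proof.
move=> x0 y0; rewrite ge0_fin_numE ?beta_integral_ge0//.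
have : (beta_integral x (y + 1) < +oo)%E.
  apply: (@le_lt_trans _ _ (x^-1)%:E); last exact: ltry.
  rewrite -integral_powR//; apply: ge0_le_integral => //.
  - by move=> u _; rewrite lee_fin mulr_ge0// powR_ge0.
  - by apply/measurable_EFinP; exact: measurable_beta_kernel.
  - by apply/measurable_EFinP; apply: measurable_funTS.
  - move=> u /=; rewrite in_itv/= => /andP[u0 u1].
    rewrite lee_fin ler_piMr ?powR_ge0// addrK.
    have := @ge0_ler_powR R y (ltW y0) (1 - u) 1; rewrite powR1 !nnegrE; apply => //.
      by rewrite subr_ge0 ltW.
    by rewrite gerBl ltW.
have := beta_integral_fubini x0 y0.
case: (beta_integral x y) (beta_integral_ge0 x y) => [r _ _ _| |//]; first exact: ltry.
rewrite gt0_muley ?lte_fin ?invr_gt0 ?addr_gt0// => _ E.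
case: (beta_integral x (y + 1)) E (beta_integral_ge0 x (y + 1)) => [r| |]//.
Qed.

Definition beta (x y : R) := fine (beta_integral x y).

Lemma betaE x y : 0 < x -> 0 < y -> beta_integral x y = (beta x y)%:E.
Proof. by move=> x0 y0; rewrite fineK// beta_integral_fin. Qed.

Lemma betaSr x y : 0 < x -> 0 < y -> beta x (y + 1) = y / (x + y) * beta x y.
Proof.
move=> x0 y0; have := beta_integral_fubini x0 y0.
have y1 : 0 < y + 1 by exact: addr_gt0.
rewrite !betaE// -!EFinM => -[E].
rewrite mulrAC -mulrA -[RHS]mulrC -[beta x (y + 1)](mulVKf (_ : y != 0)) ?gt_eqF//.
by rewrite -E; field; rewrite !gt_eqF ?addr_gt0.
Qed.

(** From u + (1 - u) = 1, beta(x, y) is the sum of the integrals with x or y raised by 1, and the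
    second of these is known. *)
Lemma betaSl x y : 0 < x -> 0 < y -> beta (x + 1) y = x / (x + y) * beta x y.
Proof.
move=> x0 y0.
suff E : beta x y = beta (x + 1) y + beta x (y + 1).
  move: (E); rewrite betaSr// => /eqP; rewrite -subr_eq => /eqP <-.
  by field; rewrite gt_eqF ?addr_gt0.
apply: EFin_inj; rewrite EFinD -!betaE ?addr_gt0// -ge0_integralD//; last 4 first.
- by move=> u _; rewrite lee_fin mulr_ge0// powR_ge0.
- by apply/measurable_EFinP; exact: measurable_beta_kernel.
- by move=> u _; rewrite lee_fin mulr_ge0// powR_ge0.
- by apply/measurable_EFinP; exact: measurable_beta_kernel.
apply: eq_integral => u; rewrite inE/= in_itv/= => /andP[u0 u1].
rewrite -EFinD !addrK; congr EFin.
rewrite -[u `^ x]mulr_powRB1 ?ltW// -[(1 - u) `^ y]mulr_powRB1 ?subr_ge0 ?ltW//.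
by ring.
Qed.

Lemma beta_ge0 x y : 0 <= beta x y.
Proof. by rewrite fine_ge0// beta_integral_ge0. Qed.

End beta_integral.

(** * Moments of the generalized Dirichlet law *)

Section dirichlet_moments.
Context {R : realType}.
Notation mu := (@lebesgue_measure R).

(* If the [W_k] are independent with common moments [m], then
   [weighted_moment m c p] is the p-th moment of [\sum_k c_k * W_k]. *)
Fixpoint weighted_moment (m : nat -> R) (c : seq R) (p : nat) : R :=
  if c is x :: c' then
    \sum_(q < p.+1) 'C(p, q)%:R * (m q * x ^+ q) * weighted_moment m c' (p - q)
  else (p == 0%N)%:R.

Definition lengths (t : R) {n} (tau : Rvec R n) : Rvec R n.+1 :=
  [tuple of rcons tau (t - \sum_(k < n) (tnth tau k : R))].

Lemma weighted_moment_ge0 m (c : seq R) p :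
  (forall q, 0 <= m q) -> all (fun x => 0 <= x) c -> 0 <= weighted_moment m c p.
Proof.
move=> m0; elim: c p => [|x c IH] p /=; first by rewrite ler0n.
move=> /andP[x0 c0]; apply: sumr_ge0 => q _.
by rewrite !mulr_ge0 ?ler0n ?m0 ?exprn_ge0 ?IH.
Qed.

Lemma tnth_cons_pair n (x : R) (y : Rvec R n) (k : 'I_n) :
  tnth (cons_pair (x, y)) (lift ord0 k) = tnth y k.
Proof. by rewrite /cons_pair/= tnthS. Qed.

Lemma sum_cons_pair n (x : R) (y : Rvec R n) :
  \sum_(k < n.+1) (tnth (cons_pair (x, y)) k : R) = x + \sum_(k < n) (tnth y k : R).
Proof.
by rewrite big_ord_recl; congr (_ + _); apply: eq_bigr => k _; rewrite tnth_cons_pair.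
Qed.

Lemma lengths_cons t n (x : R) (y : Rvec R n) :
  lengths t (cons_pair (x, y)) = x :: lengths (t - x) y :> seq R.
Proof. by rewrite /= sum_cons_pair opprD addrA. Qed.

Lemma measurable_tnth_fun d (T : measurableType d) n (f : T -> Rvec R n) (k : 'I_n) :
  measurable_fun setT f -> measurable_fun setT (fun x => tnth (f x) k : R).
Proof.
by move=> mf; apply: (measurableT_comp (f := fun y : Rvec R n => tnth y k)) => //; exact: measurable_tnth.
Qed.

Lemma measurable_lengths t n : measurable_fun setT (@lengths t n).
Proof.
apply/measurable_fun_tnthP => i /=.
have [k ->|->] := unliftP ord_max i.
  rewrite (_ : _ \o _ = fun tau => tnth tau k); last first.
    apply/funext => tau; rewrite /comp (tnth_nth 0) -[tval _]/(rcons _ _).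
    by rewrite lift_max nth_rcons size_tuple ltn_ord -tnth_nth.
  exact: measurable_tnth.
rewrite (_ : _ \o _ = fun tau => t - \sum_(k < n) (tnth tau k : R)); last first.
  by apply/funext => tau /=; rewrite (tnth_nth 0)/= nth_rcons size_tuple ltnn eqxx.
apply: measurable_funB => //; apply: measurable_sum => k.
exact: measurable_tnth.
Qed.

Lemma measurable_weighted_moment m n p :
  measurable_fun setT (fun v : Rvec R n => weighted_moment m v p).
Proof.
elim: n p => [|n IH] p.
  rewrite (_ : (fun _ => _) = cst (weighted_moment m [::] p))//.
  by apply/funext => v; rewrite (tuple0 v).
rewrite (_ : (fun _ => _) = fun v : Rvec R n.+1 =>
  \sum_(q < p.+1) 'C(p, q)%:R * (m q * (tnth v ord0 : R) ^+ q) *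
    weighted_moment m [tuple of behead v] (p - q)); last first.
  by apply/funext => v; rewrite [in LHS](tuple_eta v).
apply: measurable_sum => q; apply: measurable_funM; last first.
  apply: (measurableT_comp (f := fun v : Rvec R n => weighted_moment m v (p - q))) => //.
  exact: measurable_behead.
apply: measurable_funM => //; apply: measurable_funM => //.
apply: measurable_funX; exact: measurable_tnth.
Qed.

Lemma GD_weight_ge0 t n a b (tau : Rvec R n) : 0 <= GD_weight t a b tau.
Proof. by apply: prodr_ge0 => k _; rewrite mulr_ge0// powR_ge0. Qed.

Lemma measurable_GD_weight t n a b :
  measurable_fun setT (@GD_weight R t n a b).
Proof.
apply: measurable_prod => k _; apply: measurable_funM.
  by apply: (measurableT_comp (f := @powR R ^~ (a k.+1 - 1))) => //; exact: measurable_tnth.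
apply: (measurableT_comp (f := @powR R ^~ (b k.+1 - 1))) => //.
apply: measurable_funB => //.
under eq_fun do rewrite big_mkcond.
apply: measurable_sum => l; case: (l <= k)%N => //; exact: measurable_tnth.
Qed.

Lemma GD_weight_cons t n a b (x : R) (y : Rvec R n) :
  GD_weight t a b (cons_pair (x, y)) =
  x `^ (a 1%N - 1) * (t - x) `^ (b 1%N - 1) *
  GD_weight (t - x) (a \o S) (b \o S) y.
Proof.
rewrite /GD_weight big_ord_recl; congr (_ * _).
  congr (_ * (_ - _) `^ _).
  rewrite (bigD1 ord0)//= big1 ?addr0// => i /andP[].
  by rewrite leqn0 => /eqP i0 /eqP[]; exact/val_inj.
apply: eq_bigr => k _; rewrite tnth_cons_pair; congr (_ * _ `^ _).
rewrite -addrA -opprD; congr (_ - _).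
rewrite big_mkcond big_ord_recl/=; congr (_ + _).
rewrite [RHS]big_mkcond; apply: eq_bigr => l _.
by rewrite /bump/= !add1n ltnS tnth_cons_pair.
Qed.

Lemma simplex_cons t n (x : R) (y : Rvec R n) :
  simplex t n.+1 (cons_pair (x, y)) <-> 0 < x /\ simplex (t - x) n y.
Proof.
rewrite /simplex/= sum_cons_pair; split.
  move=> [p0 s]; split; first exact: (p0 ord0).
  split; last by rewrite ltrBrDl.
  by move=> k; have := p0 (lift ord0 k); rewrite tnth_cons_pair.
move=> [x0 [p0 s]]; split; last by rewrite -ltrBrDl.
by move=> k; have [j ->|->] := unliftP ord0 k; rewrite ?tnth_cons_pair.
Qed.

Lemma measurable_simplex t n : measurable (simplex t n : set (Rvec R n)).
Proof.
rewrite (_ : simplex t n = (\bigcap_(k in [set: 'I_n]) ((fun tau : Rvec R n => tnth tau k) @^-1` `]0, +oo[))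
   `&` ((fun tau : Rvec R n => \sum_(k < n) (tnth tau k : R)) @^-1` `]-oo, t[)); last first.
  apply/seteqP; split => [tau [p0 s]|tau [p0 s]]; split.
  - by move=> k _ /=; rewrite in_itv/= andbT.
  - by rewrite /= in_itv.
  - by move=> k; have := p0 k Logic.I; rewrite /= in_itv/= andbT.
  - by move: s; rewrite /= in_itv.
apply: measurableI.
  apply: fin_bigcap_measurable; first exact: finite_finset.
  by move=> k _; rewrite -[X in measurable X]setTI; apply: measurable_tnth => //.
rewrite -[X in measurable X]setTI; apply: measurable_sum => // k.
exact: measurable_tnth.
Qed.

Lemma ge0_integral_lebesgue_tupleS n (f : Rvec R n.+1 -> \bar R) :
  measurable_fun setT f -> (forall v, (0 <= f v)%E) ->
  (\int[lebesgue_tuple n.+1]_v f v =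
   \int[mu]_x \int[lebesgue_tuple n]_y f (cons_pair (x, y)))%E.
Proof.
move=> mf f0.
rewrite ge0_integral_pushforward//; last exact: measurable_cons_pair.
rewrite preimage_setT fubini_tonelli1//; last by move=> p; exact: f0.
by apply: measurableT_comp => //; exact: measurable_cons_pair.
Qed.


(** Unnormalized: when m 0 = 1, the value at p = 0 is the total mass of the weight. *)
Definition GD_moment (m : nat -> R) t n a b p : \bar R :=
  (\int[lebesgue_tuple n]_(tau in simplex t n)
     (weighted_moment m (lengths t tau) p * GD_weight t a b tau)%:E)%E.

Lemma lengths_ge0 t n (tau : Rvec R n) :
  simplex t n tau -> all (fun x : R => 0 <= x) (lengths t tau).
Proof.
move=> [p0 s]; rewrite all_rcons subr_ge0 ltW//=.
by apply/allP => x /(tnthP tau)[k ->]; exact: ltW.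
Qed.

Section recursion.
Variables (m : nat -> R) (m0 : forall q, 0 <= m q).

Lemma measurable_GD_integrand t n a b p (D : set (Rvec R n)) :
  measurable_fun D (fun tau =>
    (weighted_moment m (lengths t tau) p * GD_weight t a b tau)%:E).
Proof.
apply: measurable_funTS; apply/measurable_EFinP; apply: measurable_funM.
  apply: (measurableT_comp (f := fun v : Rvec R n.+1 => weighted_moment m v p)).
    exact: measurable_weighted_moment.
  exact: measurable_lengths.
exact: measurable_GD_weight.
Qed.

Lemma GD_integrand_ge0 t n a b p (tau : Rvec R n) : simplex t n tau ->
  (0 <= (weighted_moment m (lengths t tau) p * GD_weight t a b tau)%:E)%E.
Proof.
move=> st; rewrite lee_fin mulr_ge0 ?GD_weight_ge0//.
by apply: weighted_moment_ge0 => //; exact: lengths_ge0.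
Qed.

Lemma GD_moment_ge0 t n a b p : (0 <= GD_moment m t n a b p)%E.
Proof. by apply: integral_ge0 => tau; exact: GD_integrand_ge0. Qed.

(** Once the first duration x is fixed, the rest is a flight of length t - x with shifted
    parameters, for the weight as well as for the segment lengths. Tonelli separates x from the
    others. *)
Lemma GD_momentS t n a b p :
  (GD_moment m t n.+1 a b p =
   \int[mu]_(x in `]0%R, t[)
     \sum_(q < p.+1) ('C(p, q)%:R * m q * x ^+ q * (x `^ (a 1%N - 1) * (t - x) `^ (b 1%N - 1)))%:E *
        GD_moment m (t - x) n (a \o S) (b \o S) (p - q))%E.
Proof.
rewrite /GD_moment integral_mkcond ge0_integral_lebesgue_tupleS; last 2 first.
- apply/(measurable_restrictT _ _).1; first exact: measurable_simplex.
  exact: measurable_GD_integrand.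
- by move=> tau; apply: erestrict_ge0 => v; exact: GD_integrand_ge0.
rewrite [RHS]integral_mkcond; apply: eq_integral => x _; rewrite patchE.
case: ifPn => [|xN]; last first.
  apply: integral0_eq => y _; rewrite patchE ifF//; apply/negbTE; move: xN.
  rewrite !notin_setE => xN sxy; apply: xN; rewrite /= in_itv/=.
  have [x0 [y0 s]] := (simplex_cons _ _ _).1 sxy.
  by rewrite x0 -subr_gt0 (le_lt_trans _ s)// sumr_ge0// => k _; exact: ltW.
rewrite inE/= in_itv/= => /andP[x0 xt].
transitivity (\int[lebesgue_tuple n]_(y in simplex (t - x) n)
   \sum_(q < p.+1) ('C(p, q)%:R * m q * x ^+ q * (x `^ (a 1%N - 1) * (t - x) `^ (b 1%N - 1)))%:E *
   (weighted_moment m (lengths (t - x) y) (p - q) * GD_weight (t - x) (a \o S) (b \o S) y)%:E)%E.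
  rewrite [RHS]integral_mkcond; apply: eq_integral => y _; rewrite !patchE.
  have -> : (cons_pair (x, y) \in simplex t n.+1) = (y \in simplex (t - x) n).
    apply/idP/idP; rewrite !inE; first by move=> /simplex_cons[].
    by move=> sy; apply/simplex_cons.
  case: ifP => // _; rewrite lengths_cons/= GD_weight_cons big_distrl/= -sumEFin.
  by apply: eq_bigr => q _; rewrite -EFinM; congr EFin; ring.
rewrite ge0_integral_sum//; last 3 first.
- exact: measurable_simplex.
- move=> q; apply: emeasurable_funM => //; exact: measurable_GD_integrand.
- move=> q y sy; apply: mule_ge0; last exact: GD_integrand_ge0.
  by rewrite lee_fin !mulr_ge0// ?ler0n ?exprn_ge0 ?powR_ge0 ?ltW.
apply: eq_bigr => q _; rewrite ge0_integralZl//.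
- exact: measurable_simplex.
- exact: measurable_GD_integrand.
- by move=> y; exact: GD_integrand_ge0.
- by rewrite lee_fin !mulr_ge0// ?ler0n ?exprn_ge0 ?powR_ge0 ?ltW.
Qed.

End recursion.

(** Up to the factor [beta x y], these are the mixed moments of U and 1 - U for U with the Beta(x,
    y) law. *)
Lemma beta_poch (x y : R) q s : 0 < x -> 0 < y ->
  beta (x + q%:R) (y + s%:R) =
  beta x y * (poch x q * poch y s / poch (x + y) (q + s)).
Proof.
move=> x0 y0; elim: s => [|s IH].
  rewrite !addr0 poch0 addn0 mulr1; elim: q => [|q IH].
    by rewrite !poch0 addr0 divr1 mulr1.
  rewrite -natr1 addrA betaSl ?ltr_wpDr// IH !pochS.
  have q0 : 0 <= q%:R :> R by [].
  have n1 : x + y + q%:R != 0 by rewrite gt_eqF//; lra.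
  have n2 : poch (x + y) q != 0 by rewrite gt_eqF// poch_gt0// addr_gt0.
  have -> : x + q%:R + y = x + y + q%:R by ring.
  by field; rewrite n1 n2.
rewrite -natr1 addrA betaSr ?ltr_wpDr// IH addnS !pochS natrD.
have q0 : 0 <= q%:R :> R by [].
have s0 : 0 <= s%:R :> R by [].
have n1 : x + y + (q%:R + s%:R) != 0 by rewrite gt_eqF//; lra.
have n2 : poch (x + y) (q + s) != 0 by rewrite gt_eqF// poch_gt0// addr_gt0.
have -> : x + q%:R + (y + s%:R) = x + y + (q%:R + s%:R) by ring.
by field; rewrite n1 n2.
Qed.

(** Odd moments are zero, so all moments are nonnegative and the recursion needs Tonelli only,
    without integrability conditions. *)
Lemma sphere_moment_ge0 (x : R) q : 0 < x -> 0 <= sphere_moment x q.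
Proof.
move=> x0; rewrite /sphere_moment; case: ifP => // _.
by rewrite divr_ge0// ltW// poch_gt0// invr_gt0.
Qed.

Section sphere_weights.
Variables (r x0 : R) (r0 : 0 <= r) (x0_gt0 : 0 < x0).
(** Moments of the projection of one uniform direction on a vector of norm r; [x0] is half the
    dimension. *)
Let m q := r ^+ q * sphere_moment x0 q.

Let m0 q : 0 <= m q.
Proof. by rewrite mulr_ge0 ?exprn_ge0// sphere_moment_ge0. Qed.

(* [K * t ^ e] is the total mass, and the normalized moments are those of
   [r * t] times a coordinate of a uniform point of the sphere of R^(2y). *)
Definition sphere_type n a b (K e y : R) := forall t p, 0 < t ->
  GD_moment m t n a b p = (K * t `^ e * (r * t) ^+ p * sphere_moment y p)%:E.

(** No change of direction is left: a single segment of length t with an empty weight. *)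
Lemma sphere_type0 a b : sphere_type 0 a b 1 0 x0.
Proof.
move=> t p t0; rewrite /GD_moment integral_dirac//; last 2 first.
- exact: measurable_simplex.
- exact: measurable_GD_integrand.
have st : simplex t 0 ([tuple] : Rvec R 0) by split; [case|rewrite big_ord0].
rewrite diracE mem_set// mul1e.
rewrite /GD_weight !big_ord0 powRr0 /= big_ord_recr/= big_ord0 subr0.
rewrite subnn binn big1 ?mulr1n; first by rewrite /m exprMn; congr EFin; ring.
by move=> q _; rewrite subn_eq0 leqNgt ltn_ord mulr0.
Qed.

(** The remaining flight contributes (t-x)^(e+p-q), so the integral over x is a Beta integral with
    parameters a_1 + q and b_1 + e + (p - q). Thus b_1 + e is the total parameter of the rest, and
    [moment_conv] evaluates the resulting sum. *)
Lemma sphere_typeS n a b K e y z : 0 <= K -> 0 < y ->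
  0 < a 1%N -> 0 < b 1%N + e ->
  moment_conv (a 1%N) x0 (b 1%N + e) y z ->
  sphere_type n (a \o S) (b \o S) K e y ->
  sphere_type n.+1 a b (K * beta (a 1%N) (b 1%N + e)) (a 1%N + (b 1%N + e) - 1) z.
Proof.
move=> K0 y0 a0 be0 conv st t p t0.
set a1 := a 1%N in a0 conv *; set b1 := b 1%N in be0 conv *.
rewrite GD_momentS//.
transitivity (\int[mu]_(x in `]0%R, t[) \sum_(q < p.+1)
  (('C(p, q)%:R * m q * (K * r ^+ (p - q) * sphere_moment y (p - q)))%:E *
   (x `^ (a1 + q%:R - 1) * (t - x) `^ (b1 + e + (p - q)%:R - 1))%:E))%E.
  apply: eq_integral => x; rewrite inE/= in_itv/= => /andP[x_gt0 xt].
  have tx0 : 0 < t - x by rewrite subr_gt0.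
  apply: eq_bigr => q _; rewrite st// -!EFinM; congr EFin.
  have xn0 : x != 0 by rewrite gt_eqF.
  have txn0 : t - x != 0 by rewrite gt_eqF.
  rewrite (_ : a1 + q%:R - 1 = (a1 - 1) + q%:R); last by ring.
  rewrite [x `^ (_ + q%:R)]powRD ?xn0 ?implybT// powR_mulrn ?ltW//.
  rewrite (_ : b1 + e + _ - 1 = (b1 - 1) + e + (p - q)%:R); last by ring.
  rewrite [(t - x) `^ (_ + (p - q)%:R)]powRD ?txn0 ?implybT//.
  rewrite [(t - x) `^ (_ + e)]powRD ?txn0 ?implybT//.
  by rewrite powR_mulrn ?ltW// exprMn; ring.
have c0 q : 0 <= 'C(p, q)%:R * m q * (K * r ^+ (p - q) * sphere_moment y (p - q)).
  by rewrite !mulr_ge0 ?ler0n ?exprn_ge0 ?sphere_moment_ge0.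
rewrite ge0_integral_sum//; last 2 first.
- move=> q; apply: emeasurable_funM => //.
  by apply/measurable_EFinP; exact: measurable_beta_kernel.
- by move=> q x _; rewrite mule_ge0 ?lee_fin// mulr_ge0 ?powR_ge0.
transitivity (\sum_(q < p.+1) ('C(p, q)%:R * m q * (K * r ^+ (p - q) * sphere_moment y (p - q)) *
   (t `^ (a1 + (b1 + e) - 1) * t ^+ p *
    (beta a1 (b1 + e) * (poch a1 q * poch (b1 + e) (p - q) / poch (a1 + (b1 + e)) p))))%:E)%E.
  apply: eq_bigr => q _; rewrite ge0_integralZl//; last 3 first.
  - by apply/measurable_EFinP; exact: measurable_beta_kernel.
  - by move=> x _; rewrite lee_fin mulr_ge0 ?powR_ge0.
  - by rewrite lee_fin.
  have qp : (q <= p)%N by rewrite -ltnS.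
  have aq0 : 0 < a1 + q%:R by rewrite ltr_wpDr.
  have bq0 : 0 < b1 + e + (p - q)%:R by rewrite ltr_wpDr.
  rewrite beta_integral_scale// betaE// -!EFinM; congr EFin.
  rewrite beta_poch// subnKC//; congr (_ * (_ * _)).
  rewrite (_ : a1 + q%:R + (b1 + e + (p - q)%:R) - 1 = a1 + (b1 + e) - 1 + p%:R).
    by rewrite powRD ?powR_mulrn ?(ltW t0)// (gt_eqF t0) implybT.
  by rewrite natrB//; ring.
rewrite sumEFin; congr EFin.
have pn0 : poch (a1 + (b1 + e)) p != 0 by rewrite gt_eqF// poch_gt0// addr_gt0.
transitivity (K * beta a1 (b1 + e) * t `^ (a1 + (b1 + e) - 1) * (r * t) ^+ p *
   (\sum_(q < p.+1) 'C(p, q)%:R * (sphere_moment x0 q * poch a1 q)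
     * (sphere_moment y (p - q) * poch (b1 + e) (p - q))) / poch (a1 + (b1 + e)) p).
  rewrite big_distrr/= big_distrl/=; apply: eq_bigr => q _.
  rewrite /m exprMn -[in r ^+ p](@subnKC q p) ?leq_ord// exprD.
  by ring.
by rewrite conv; field.
Qed.

End sphere_weights.

(** * The recursion for the parameters of the flights *)

Section GD_chain.
Variables (r : R) (d j n : nat) (h i : bool).
Hypotheses (r0 : 0 <= r) (d3 : (3 <= d)%N) (j1 : (1 <= j)%N) (jn : (j < n)%N).
Let s0 : R := d%:R / 2 - 1.
Let a : nat -> R := GD_a (d := d) j n.
Let b : nat -> R := GD_b (d := d) h i j n.
(** Half of (u+1)(d-2) + 2, the dimension whose uniform direction has the moments of the last u + 1
    segments. *)
Let tail_param u : R := (u.+1)%:R * s0 + 1.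

Let s0_gt0 : 2^-1 <= s0.
Proof.
rewrite /s0; have : 3%:R <= d%:R :> R by rewrite ler_nat.
by lra.
Qed.

Let tail_param_gt u : 1 + 2^-1 <= tail_param u.
Proof.
rewrite /tail_param -[u.+1%:R]natr1 mulrDl mul1r.
have : 0 <= u%:R * s0 by rewrite mulr_ge0//; have := s0_gt0; lra.
by have := s0_gt0; lra.
Qed.

Let tail_paramS u : tail_param u.+1 = tail_param u + s0.
Proof. by rewrite /tail_param -[u.+2%:R]natr1; ring. Qed.

Let shiftS (f : nat -> R) l : (fun k => f (l + k)%N) \o S = (fun k => f (l.+1 + k)%N).
Proof. by apply/funext => k /=; rewrite addnS. Qed.

Let bool_le (c : bool) : (0 <= c%:R :> R) * (c%:R <= 1 :> R).
Proof. by case: c; split; rewrite /= ?lexx ?ler01. Qed.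

(** The total parameter of the rest is always [tail_param u - i]: it is b_n = d/2 - i when u = 0,
    where no integration has produced a power of t yet, and 1 + e afterwards. So i = 0 stays in the
    case of [moment_conv_catalanB] and i = 1 in that of [moment_conv_catalanA]. *)
Lemma GD_tail_sphere_type u : (u <= n - j)%N -> exists2 K : R, 0 <= K &
  sphere_type r (d%:R / 2) u (fun k => a (n - u + k)%N) (fun k => b (n - u + k)%N)
    K (if u == 0%N then 0 else tail_param u - i%:R - 1) (tail_param u).
Proof.
have y0 v : 0 < tail_param v by have := tail_param_gt v; lra.
have x00 : 0 < d%:R / 2 :> R by have := s0_gt0; rewrite /s0; lra.
elim: u => [_|u IH unj].
  exists 1 => //=; rewrite (_ : tail_param 0 = d%:R / 2); last by rewrite /tail_param /s0; ring.
  exact: sphere_type0.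
have [K K0 st] := IH (ltnW unj).
have aE : a (n - u.+1 + 1)%N = s0.
  by rewrite /a /GD_a ifF//; apply/negbTE; lia.
have bE : b (n - u.+1 + 1)%N + (if u == 0%N then 0 else tail_param u - i%:R - 1) =
    tail_param u - i%:R.
  rewrite /b /GD_b ifF; last by apply/negbTE; lia.
  rewrite ifF; last by apply/negbTE; lia.
  have [->|u0] := eqVneq u 0%N.
    by rewrite ifT; [rewrite /tail_param /s0; ring|lia].
  by rewrite ifF; [ring|apply/negbTE; lia].
exists (K * beta s0 (tail_param u - i%:R)).
  by rewrite mulr_ge0// beta_ge0.
rewrite /= tail_paramS.
have -> : tail_param u + s0 - i%:R - 1 = s0 + (tail_param u - i%:R) - 1 by ring.
rewrite -bE -aE; apply: (@sphere_typeS r _ r0 x00 u (fun k => a (n - u.+1 + k)%N) (fun k => b (n - u.+1 + k)%N)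
    K _ (tail_param u) _ K0 (y0 u)).
- by rewrite aE; have := s0_gt0; lra.
(* The bound d >= 3 keeps this Beta parameter at least 1/2, also for i = 1. *)
- by rewrite bE; have := tail_param_gt u; have [] := bool_le i; lra.
- rewrite aE bE (_ : _ + s0 = d%:R / 2 + tail_param u - 1); last by rewrite /s0; ring.
  have z0 : 0 < d%:R / 2 + tail_param u - 1.
    by have := tail_param_gt u; have := s0_gt0; rewrite /s0; lra.
  case: i; last by rewrite subr0; exact: moment_conv_catalanB.
  exact: moment_conv_catalanA.
- by rewrite !shiftS (_ : (n - u.+1).+1 = n - u)%N//; lia.
Qed.

(** Each of the first segments adds (d-1)/2 to y and d - 1 to the total parameter, which therefore
    stays at 2y - 1 + h, one of the two Vandermonde cases. The count is v + 1 because the step with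
    b_j has to come first. *)
Lemma GD_head_sphere_type v : (v < j)%N -> exists2 K : R, 0 <= K &
  let y := tail_param (n - j) + v.+1%:R * ((d%:R - 1) / 2) in
  sphere_type r (d%:R / 2) (n - j + v.+1) (fun k => a (j - v.+1 + k)%N) (fun k => b (j - v.+1 + k)%N)
    K (2 * y + h%:R - 2) y.
Proof.
pose y v := tail_param (n - j) + v%:R * ((d%:R - 1) / 2) : R.
have x00 : 0 < d%:R / 2 :> R by have := s0_gt0; rewrite /s0; lra.
have y1 w : 1 + 2^-1 <= y w.
  have := tail_param_gt (n - j); have : 0 <= w%:R * ((d%:R - 1) / 2) :> R.
    by rewrite mulr_ge0//; have := s0_gt0; rewrite /s0; lra.
  by rewrite /y; lra.
have yS w : y w.+1 = d%:R / 2 + y w - 2^-1.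
  by rewrite /y -[w.+1%:R]natr1; field.
have step w K e : (w < j)%N -> 0 <= K ->
   b (j - w.+1 + 1)%N + e = 2 * y w - 1 + h%:R ->
   sphere_type r (d%:R / 2) (n - j + w) (fun k => a (j - w + k)%N) (fun k => b (j - w + k)%N)
     K e (y w) ->
   exists2 K' : R, 0 <= K' &
   sphere_type r (d%:R / 2) (n - j + w.+1) (fun k => a (j - w.+1 + k)%N) (fun k => b (j - w.+1 + k)%N)
     K' (2 * y w.+1 + h%:R - 2) (y w.+1).
  move=> wj K0 bE st.
  have aE : a (j - w.+1 + 1)%N = d%:R - 1.
    by rewrite /a /GD_a ifT//; lia.
  exists (K * beta (d%:R - 1) (2 * y w - 1 + h%:R)).
    by rewrite mulr_ge0// beta_ge0.
  have -> : 2 * y w.+1 + h%:R - 2 = d%:R - 1 + (2 * y w - 1 + h%:R) - 1 by rewrite yS; field.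
  rewrite -bE -aE addnS; have w0 : 0 < y w by have := y1 w; lra.
  apply: (@sphere_typeS r _ r0 x00 _ (fun k => a (j - w.+1 + k)%N) (fun k => b (j - w.+1 + k)%N)
    K _ (y w) _ K0 w0).
  - by rewrite aE; have := s0_gt0; rewrite /s0; lra.
  - by rewrite bE; have := y1 w; have [] := bool_le h; lra.
  - rewrite aE bE yS.
    have z0 : 0 < d%:R / 2 + y w - 2^-1 by have := y1 w; lra.
    have -> : d%:R - 1 = 2 * (d%:R / 2) - 1 :> R by field.
    case: h; last by rewrite addr0; exact: moment_conv_vandermonde1.
    by rewrite subrK; exact: moment_conv_vandermonde2.
  - by rewrite !shiftS (_ : (j - w.+1).+1 = j - w)%N//; lia.
elim: v => [j0|v IH vj]; last first.
  have [K K0 st] := IH (ltnW vj).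
  apply: (step _ _ _ vj K0 _ st).
  rewrite /b /GD_b ifF; last by apply/negbTE; lia.
  rewrite ifF; last by apply/negbTE; lia.
  by rewrite ifF; [rewrite /y; ring|apply/negbTE; lia].
have [K K0] := GD_tail_sphere_type (leqnn (n - j)).
rewrite ifF; last by apply/negbTE; lia.
rewrite subKn ?(ltnW jn)// => st.
(* The summand i of b_j cancels the -i of the exponent, and doubling (n-j+1)(d/2-1) produces 2y - 1
   + h. *)
apply: (step 0%N K (tail_param (n - j) - i%:R - 1)) => //.
  rewrite /b /GD_b ifF; last by apply/negbTE; lia.
  rewrite ifT; last by lia.
  by rewrite /y /tail_param /s0 addn1; ring.
by rewrite addn0 subn0 /y mul0r addr0.
Qed.

End GD_chain.

(** The order of the quantifiers is the point: y is common to all h and i, whereas K and e may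
    depend on them. *)
Lemma GD_sphere_type (r : R) d j n : 0 <= r -> (3 <= d)%N -> (1 <= j)%N -> (j < n)%N ->
  exists y : R, forall h i, exists K e : R,
    sphere_type r (d%:R / 2) n (GD_a (d := d) j n) (GD_b (d := d) h i j n) K e y.
Proof.
move=> r0 d3 j1 jn; eexists => h i.
have j1j : (j.-1 < j)%N by lia.
have [K K0] := GD_head_sphere_type h i r0 d3 j1 jn j1j.
rewrite prednK// subnn subnK ?(ltnW jn)// => st.
by exists K; eexists; exact: st.
Qed.

End dirichlet_moments.

(** * Bounded random vectors with the same moments *)

Section bounded_measurable.
Context {R : realType} d (T : measurableType d) (P : probability T R).
Implicit Types f g : T -> R.

(** Bounded everywhere, hence integrable for every probability and stable under sums and
    products. *)
Definition bounded_measurable f :=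
  measurable_fun [set: T] f /\ exists B : R, forall w, `|f w| <= B.

Lemma bounded_measurable_integrable f :
  bounded_measurable f -> P.-integrable setT (EFin \o f).
Proof.
move=> [mf [B fB]]; apply: measurable_bounded_integrable => //; first exact: fin_num_fun_lty.
exists B; split; rewrite ?num_real// => M BM w _.
by rewrite /= (le_trans (fB w))// ltW.
Qed.

Lemma bounded_measurable_cst (c : R) : bounded_measurable (cst c).
Proof. by split => //; exists `|c|. Qed.

Lemma bounded_measurableD f g : bounded_measurable f -> bounded_measurable g ->
  bounded_measurable (fun w => f w + g w).
Proof.
move=> [mf [B fB]] [mg [C gC]]; split; first exact: measurable_funD.
by exists (B + C) => w; rewrite (le_trans (ler_normD _ _))// lerD.
Qed.

Lemma bounded_measurableM f g : bounded_measurable f -> bounded_measurable g ->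
  bounded_measurable (fun w => f w * g w).
Proof.
move=> [mf [B fB]] [mg [C gC]]; split; first exact: measurable_funM.
by exists (B * C) => w; rewrite normrM ler_pM.
Qed.

Lemma bounded_measurableX f n : bounded_measurable f ->
  bounded_measurable (fun w => f w ^+ n).
Proof.
move=> bf; elim: n => [|n IH].
  by under eq_fun do rewrite expr0; exact: bounded_measurable_cst.
by under eq_fun do rewrite exprS; exact: bounded_measurableM.
Qed.

Lemma bounded_measurable_sum I (s : seq I) (F : I -> T -> R) :
  (forall i, bounded_measurable (F i)) ->
  bounded_measurable (fun w => \sum_(i <- s) F i w).
Proof.
move=> bF; elim: s => [|i s IH].
  by under eq_fun do rewrite big_nil; exact: bounded_measurable_cst.
by under eq_fun do rewrite big_cons; exact: bounded_measurableD.
Qed.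

Lemma bounded_measurable_prod I (s : seq I) (F : I -> T -> R) :
  (forall i, bounded_measurable (F i)) ->
  bounded_measurable (fun w => \prod_(i <- s) F i w).
Proof.
move=> bF; elim: s => [|i s IH].
  by under eq_fun do rewrite big_nil; exact: bounded_measurable_cst.
by under eq_fun do rewrite big_cons; exact: bounded_measurableM.
Qed.

Lemma Rintegral_sum I (s : seq I) (F : I -> T -> R) :
  (forall i, bounded_measurable (F i)) ->
  \int[P]_w (\sum_(i <- s) F i w) = \sum_(i <- s) \int[P]_w F i w.
Proof.
move=> bF; elim: s => [|i s IH].
  rewrite big_nil; under eq_Rintegral do rewrite big_nil.
  by rewrite Rintegral_cst// mul0r.
rewrite big_cons -IH; under eq_Rintegral do rewrite big_cons.
rewrite RintegralD//; apply: bounded_measurable_integrable => //.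
exact: bounded_measurable_sum.
Qed.

Lemma RintegralZ_bounded (c : R) f : bounded_measurable f ->
  \int[P]_w (c * f w) = c * \int[P]_w f w.
Proof. by move=> bf; rewrite RintegralZl//; exact: bounded_measurable_integrable. Qed.

Lemma Rintegral_probability_cst (c : R) : \int[P]_w c = c.
Proof. by rewrite Rintegral_cst// [X in fine X]probability_setT mulr1. Qed.

End bounded_measurable.

(** * From moments of projections to means of polynomials *)

Section moment_determinacy.
Context {R : realType} d1 d2 (T1 : measurableType d1) (T2 : measurableType d2)
  (P1 : probability T1 R) (P2 : probability T2 R).

Definition same_mean (f1 : T1 -> R) (f2 : T2 -> R) :=
  \int[P1]_w f1 w = \int[P2]_w f2 w.

(* Polarization: a polynomial in the coefficient of [u 0] which vanishes
   identically has zero coefficients. *)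
Lemma same_mean_monomials n (u1 : nat -> T1 -> R) (u2 : nat -> T2 -> R) g1 g2 :
  (forall k, bounded_measurable (u1 k)) -> (forall k, bounded_measurable (u2 k)) ->
  bounded_measurable g1 -> bounded_measurable g2 ->
  (forall (xi : nat -> R) p,
     same_mean (fun w => g1 w * (\sum_(k < n) xi k * u1 k w) ^+ p)
               (fun w => g2 w * (\sum_(k < n) xi k * u2 k w) ^+ p)) ->
  forall e : nat -> nat,
    same_mean (fun w => g1 w * \prod_(k < n) u1 k w ^+ e k)
              (fun w => g2 w * \prod_(k < n) u2 k w ^+ e k).
Proof.
elim: n u1 u2 g1 g2 => [|n IH] u1 u2 g1 g2 b1 b2 bg1 bg2 H e.
  have E d (T : measurableType d) (g : T -> R) (u : nat -> T -> R) :
      (fun w => g w * \prod_(k < 0) u k w ^+ e k) =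
      (fun w => g w * (\sum_(k < 0) 0 * u k w) ^+ 0).
    by apply/funext => w; rewrite big_ord0 expr0.
  by rewrite !E; exact: (H (fun=> 0)).
rewrite /same_mean; under eq_Rintegral do rewrite big_ord_recl mulrA.
under [in RHS]eq_Rintegral do rewrite big_ord_recl mulrA.
pose s1 (xi : nat -> R) w := \sum_(k < n) xi k * u1 k.+1 w.
pose s2 (xi : nat -> R) w := \sum_(k < n) xi k * u2 k.+1 w.
have bs1 xi : bounded_measurable (s1 xi).
  by apply: bounded_measurable_sum => k; apply: bounded_measurableM => //; exact: bounded_measurable_cst.
have bs2 xi : bounded_measurable (s2 xi).
  by apply: bounded_measurable_sum => k; apply: bounded_measurableM => //; exact: bounded_measurable_cst.
(* The power of the first variable is absorbed into the weight g, which is why the statement carries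
   a weight. *)
apply: (IH (fun k => u1 k.+1) (fun k => u2 k.+1) (fun w => g1 w * u1 0%N w ^+ e 0%N)
          (fun w => g2 w * u2 0%N w ^+ e 0%N) _ _ _ _ _ (fun k => e k.+1)) => //.
- by apply: bounded_measurableM => //; exact: bounded_measurableX.
- by apply: bounded_measurableM => //; exact: bounded_measurableX.
move=> xi p.
(* With this total degree, the coefficient of index e 0 leaves exactly the power p of the other
   variables. *)
pose q := (e 0%N + p)%N.
pose c1 (l : nat) := \int[P1]_w (g1 w * (u1 0%N w ^+ l * s1 xi w ^+ (q - l))).
pose c2 (l : nat) := \int[P2]_w (g2 w * (u2 0%N w ^+ l * s2 xi w ^+ (q - l))).
suff : \poly_(l < q.+1) ((c1 l - c2 l) *+ 'C(q, l)) = 0.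
  move/(congr1 (fun r : {poly R} => r`_(e 0%N))); rewrite coef_poly coef0 ltnS leq_addr.
  move=> /eqP; rewrite mulrn_eq0 -[_ == 0%N]negbK -lt0n bin_gt0 leq_addr/= subr_eq0 => /eqP.
  rewrite /c1 /c2 /same_mean /q addKn => E.
  under eq_Rintegral do rewrite -mulrA.
  by rewrite E; apply: eq_Rintegral => w _; rewrite mulrA.
apply: poly_nat_roots0 => n0; move: (n0%:R : R) => x; rewrite horner_poly.
have := H (fun k => if k is k'.+1 then xi k' else x) q; rewrite /same_mean.
under eq_Rintegral do rewrite big_ord_recl/= addrC exprDn big_distrr/=.
under [in RHS]eq_Rintegral do rewrite big_ord_recl/= addrC exprDn big_distrr/=.
have E d (T : measurableType d) (P : probability T R) (g u s : T -> R) :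
    bounded_measurable g -> bounded_measurable u -> bounded_measurable s ->
    \int[P]_w (\sum_(l < q.+1) g w * (s w ^+ (q - l) * (x * u w) ^+ l *+ 'C(q, l))) =
    \sum_(l < q.+1) (\int[P]_w (g w * (u w ^+ l * s w ^+ (q - l)))) *+ 'C(q, l) * x ^+ l.
  move=> bg bu bs.
  have bb (l : 'I_q.+1) : bounded_measurable (fun w => g w * (u w ^+ l * s w ^+ (q - l))).
    by do 2 apply: bounded_measurableM => //; exact: bounded_measurableX.
  transitivity (\int[P]_w (\sum_(l < q.+1)
      ('C(q, l)%:R * x ^+ l) * (g w * (u w ^+ l * s w ^+ (q - l))))).
    apply: eq_Rintegral => w _; apply: eq_bigr => l _.
    by rewrite exprMn -[_ *+ 'C(q, l)]mulr_natl; ring.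
  rewrite Rintegral_sum; last first.
    by move=> l; apply: bounded_measurableM => //; exact: bounded_measurable_cst.
  by apply: eq_bigr => l _; rewrite RintegralZ_bounded// -mulr_natl; ring.
move=> HH.
have := etrans (etrans (esym (E _ _ P1 g1 (u1 0%N) (s1 xi) bg1 (b1 0%N) (bs1 xi))) HH)
  (E _ _ P2 g2 (u2 0%N) (s2 xi) bg2 (b2 0%N) (bs2 xi)).
move=> /eqP; rewrite -subr_eq0 -sumrB => /eqP E0; rewrite -[RHS]E0.
by apply: eq_bigr => l _; rewrite mulrnBl mulrBl.
Qed.

(** Linearity, one variable at a time, with the polynomial in the first variable moved into the
    weight. *)
Lemma same_mean_polys n (u1 : nat -> T1 -> R) (u2 : nat -> T2 -> R) g1 g2 :
  (forall k, bounded_measurable (u1 k)) -> (forall k, bounded_measurable (u2 k)) ->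
  bounded_measurable g1 -> bounded_measurable g2 ->
  (forall e : nat -> nat,
    same_mean (fun w => g1 w * \prod_(k < n) u1 k w ^+ e k)
              (fun w => g2 w * \prod_(k < n) u2 k w ^+ e k)) ->
  forall Q : nat -> {poly R},
    same_mean (fun w => g1 w * \prod_(k < n) (Q k).[u1 k w])
              (fun w => g2 w * \prod_(k < n) (Q k).[u2 k w]).
Proof.
elim: n u1 u2 g1 g2 => [|n IH] u1 u2 g1 g2 b1 b2 bg1 bg2 H Q.
  have E d (T : measurableType d) (g : T -> R) (u : nat -> T -> R) :
      (fun w => g w * \prod_(k < 0) (Q k).[u k w]) =
      (fun w => g w * \prod_(k < 0) u k w ^+ 0).
    by apply/funext => w; rewrite !big_ord0.
  by rewrite !E; exact: (H (fun=> 0%N)).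
have bQ d (T : measurableType d) (u : T -> R) (p : {poly R}) : bounded_measurable u ->
    bounded_measurable (fun w => p.[u w]).
  move=> bu; under eq_fun do rewrite horner_coef.
  apply: bounded_measurable_sum => k; apply: bounded_measurableM.
    exact: bounded_measurable_cst.
  exact: bounded_measurableX.
rewrite /same_mean; under eq_Rintegral do rewrite big_ord_recl mulrA.
under [in RHS]eq_Rintegral do rewrite big_ord_recl mulrA.
apply: (IH (fun k => u1 k.+1) (fun k => u2 k.+1) (fun w => g1 w * (Q 0%N).[u1 0%N w])
          (fun w => g2 w * (Q 0%N).[u2 0%N w]) _ _ _ _ _ (fun k => Q k.+1)) => //.
- by apply: bounded_measurableM => //; exact: bQ.
- by apply: bounded_measurableM => //; exact: bQ.
move=> e.
have E d (T : measurableType d) (P : probability T R) (g : T -> R) (u : nat -> T -> R) :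
  bounded_measurable g -> (forall k, bounded_measurable (u k)) ->
  \int[P]_w (g w * (Q 0%N).[u 0%N w] * \prod_(k < n) u k.+1 w ^+ e k) =
  \sum_(l < size (Q 0%N)) (Q 0%N)`_l *
    \int[P]_w (g w * \prod_(k < n.+1) u k w ^+ (if (k : nat) is k'.+1 then e k' else l)).
  move=> bg bu.
  have bb (l : 'I_(size (Q 0%N))) : bounded_measurable (fun w =>
      g w * \prod_(k < n.+1) u k w ^+ (if (k : nat) is k'.+1 then e k' else l)).
    apply: bounded_measurableM => //; apply: bounded_measurable_prod => k.
    exact: bounded_measurableX.
  under [in RHS]eq_bigr do rewrite -RintegralZ_bounded//.
  rewrite -Rintegral_sum; last first.
    by move=> l; apply: bounded_measurableM => //; exact: bounded_measurable_cst.
  apply: eq_Rintegral => w _; rewrite horner_coef big_distrr/= big_distrl/=.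
  by apply: eq_bigr => l _; rewrite big_ord_recl/=; ring.
rewrite /same_mean !E//; apply: eq_bigr => l _; congr (_ * _).
exact: (H (fun k => if k is k'.+1 then e k' else l)).
Qed.

End moment_determinacy.

(** * Polynomials approximating a step function *)

Section step_polynomial.
Context {R : realType}.
Implicit Types y : R.

Lemma bernoulli_ler (x : R) n : 0 <= x <= 1 -> 1 - n%:R * x <= (1 - x) ^+ n.
Proof.
move=> /andP[x0 x1]; elim: n => [|n IH]; first by rewrite mul0r subr0 expr0.
have : (1 - x) * (1 - n%:R * x) <= (1 - x) ^+ n.+1.
  by rewrite exprS ler_wpM2l// subr_ge0.
apply: le_trans; rewrite -natr1.
have : 0 <= n%:R * x * x by rewrite !mulr_ge0.
by lra.
Qed.

Lemma bernoulli_ger (x : R) n : 0 <= x -> 1 + n%:R * x <= (1 + x) ^+ n.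
Proof.
move=> x0; elim: n => [|n IH]; first by rewrite mul0r addr0 expr0.
have : (1 + x) * (1 + n%:R * x) <= (1 + x) ^+ n.+1.
  by rewrite exprS ler_wpM2l// addr_ge0.
apply: le_trans; rewrite -natr1.
have : 0 <= n%:R * x * x by rewrite !mulr_ge0.
by lra.
Qed.

(** With s the square root of x, Bernoulli's inequality for 2 - s and s (2 - s) <= 1 bound n s^n by
    1/(1-s); the other factor s^n tends to 0. *)
Lemma natmul_exp_cvg0 (x : R) : 0 <= x < 1 -> (fun n => n%:R * x ^+ n) @ \oo --> 0.
Proof.
move=> /andP[x0 x1]; pose s := Num.sqrt x.
have s0 : 0 <= s by exact: sqrtr_ge0.
have s1 : s < 1.
  by rewrite -(sqrtr1 R) ltr_sqrt.
have ss : s ^+ 2 = x by rewrite sqr_sqrtr.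
have bnd n : n%:R * s ^+ n <= (1 - s)^-1.
  rewrite -[leRHS]mul1r ler_pdivlMr ?subr_gt0//.
  have h := @bernoulli_ger (1 - s) n; rewrite subr_ge0 (ltW s1) in h.
  have h1 : s ^+ n * (1 + n%:R * (1 - s)) <= s ^+ n * (1 + (1 - s)) ^+ n.
    by rewrite ler_wpM2l ?exprn_ge0// h.
  have h2 : s ^+ n * (1 + (1 - s)) ^+ n <= 1.
    rewrite -exprMn exprn_ile1//; first by rewrite mulr_ge0//; lra.
    by rewrite -subr_ge0 (_ : 1 - s * (1 + (1 - s)) = (1 - s) ^+ 2) ?sqr_ge0//; ring.
  have h3 : 0 <= s ^+ n by rewrite exprn_ge0.
  rewrite (_ : n%:R * s ^+ n * (1 - s) = s ^+ n * (1 + n%:R * (1 - s)) - s ^+ n); last by ring.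
  by lra.
apply: (@squeeze_cvgr _ _ _ _ (fun=> 0) (fun n => (1 - s)^-1 * s ^+ n)).
- near=> n; rewrite mulr_ge0 ?exprn_ge0//=.
  by rewrite -ss -exprM mulnC exprM expr2 mulrA ler_wpM2r// exprn_ge0.
- exact: cvg_cst.
- by apply: cvg_geometric; rewrite ger0_norm.
Unshelve. all: by end_near. Qed.

(* The exponent grows slightly faster than [2 ^ n] so that the limit is 0 also at
   the threshold [y = 1/2]. *)
Lemma step_polynomial_cvg y : 0 <= y <= 1 ->
  (fun n => (1 - y ^+ n) ^+ (n * 2 ^ n)) @ \oo --> ((y < 2^-1)%R%:R : R).
Proof.
move=> /andP[y0 y1].
have yn n : 0 <= y ^+ n <= 1 by rewrite exprn_ge0// exprn_ile1.
have [yh|yh] := ltP y 2^-1.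
  apply: (@squeeze_cvgr _ _ _ _ (fun n => 1 - n%:R * (2 * y) ^+ n) (fun=> 1)).
  - near=> n; apply/andP; split; last first.
      by have /andP[a b] := yn n; rewrite exprn_ile1 ?subr_ge0// gerBl.
    apply: le_trans (bernoulli_ler _ (yn n)).
    by rewrite natrM natrX exprMn mulrA.
  - rewrite -[X in _ --> X]subr0; apply: cvgB; first exact: cvg_cst.
    by apply: natmul_exp_cvg0; lra.
  - exact: cvg_cst.
(* With M = n 2^n, (1 - y^n)^M (1 + y^n)^M <= 1, while (1 + y^n)^M >= 1 + n (2y)^n >= n + 1. *)
apply: (@squeeze_cvgr _ _ _ _ (fun=> 0) (fun n => n.+1%:R^-1)).
- near=> n; have /andP[a b] := yn n; apply/andP; split.
    by rewrite exprn_ge0// subr_ge0.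
  rewrite -[leRHS]mul1r ler_pdivlMr//.
  apply: (@le_trans _ _ ((1 - y ^+ n) ^+ (n * 2 ^ n) * (1 + y ^+ n) ^+ (n * 2 ^ n))).
    rewrite ler_wpM2l ?exprn_ge0 ?subr_ge0//.
    apply: le_trans (bernoulli_ger _ a).
    rewrite -natr1 addrC lerD2l natrM natrX -mulrA -exprMn ler_peMr//.
    by apply: exprn_ege1; lra.
  rewrite -exprMn exprn_ile1//.
    by rewrite mulr_ge0 ?subr_ge0 ?addr_ge0.
  rewrite (_ : (1 - y ^+ n) * (1 + y ^+ n) = 1 - (y ^+ n) ^+ 2); last by ring.
  by rewrite gerBl exprn_ge0.
- exact: cvg_cst.
- exact: cvg_harmonic.
Unshelve. all: by end_near. Qed.

End step_polynomial.

Section box_uniqueness.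
Context {R : realType} (d : nat).

Definition lower_box (a : 'I_d -> R) : set (Rvec R d) :=
  [set v | forall i, (tnth v i : R) < a i].

Lemma measurable_tnth_preimage (i : 'I_d) (B : set R) : measurable B ->
  measurable ((fun v : Rvec R d => tnth v i) @^-1` B).
Proof. by move=> mB; rewrite -[X in measurable X]setTI; exact: measurable_tnth. Qed.

Lemma lower_boxE a : lower_box a =
  \bigcap_(i in [set: 'I_d]) ((fun v : Rvec R d => tnth v i) @^-1` `]-oo, a i[).
Proof.
by apply/seteqP; split => v H i; have := H i; rewrite /= in_itv/=; [|apply].
Qed.

Lemma measurable_lower_box a : measurable (lower_box a).
Proof.
rewrite lower_boxE; apply: fin_bigcap_measurable; first exact: finite_finset.
by move=> i _; exact: measurable_tnth_preimage.
Qed.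

(** Lower boxes are stable under intersection, exhaust the space and generate the sigma-algebra: a
    half-space in one coordinate is the union of boxes whose other bounds are k. *)
Lemma lower_box_measure_unique (m1 m2 : {measure set (Rvec R d) -> \bar R}) :
  (m1 setT < +oo)%E -> (forall a, m1 (lower_box a) = m2 (lower_box a)) ->
  forall A, measurable A -> m1 A = m2 A.
Proof.
move=> fin1 m12.
pose G := range lower_box.
have cover : \bigcup_k lower_box (fun=> k%:R) = setT.
  apply/seteqP; split => // v _.
  pose M := \sum_(i < d) `|tnth v i : R|.
  exists (Num.bound M) => // i; have M0 : 0 <= M by exact: sumr_ge0.
  rewrite (le_lt_trans _ (archi_boundP M0))// (le_trans (ler_norm _))//.
  by rewrite /M (bigD1 i)//= lerDl sumr_ge0.
have mG : G `<=` measurable by move=> _ [a _ <-]; exact: measurable_lower_box.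
apply: (measure_unique G (fun k => lower_box (fun=> k%:R))).
- apply/seteqP; split; last first.
    apply: smallest_sub => //; exact: sigma_algebra_measurable.
  apply: smallest_sub; first exact: smallest_sigma_algebra.
  apply: (big_ind (fun S => S `<=` <<s G >>)) => //.
    by move=> S1 S2 S1G S2G; rewrite subUset.
  move=> i _ _ [B mB <-]; rewrite setTI.
  pose f (v : g_sigma_algebraType G) : R := tnth v i.
  suff mf : measurable_fun setT f by have := mf measurableT B mB; rewrite setTI.
  apply: (measurability _ (RGenInftyO.measurableE R)) => _ [_ [x ->] <-].
  rewrite setTI (_ : f @^-1` _ = \bigcup_k lower_box (fun l => if l == i then x else k%:R)).
    by apply: bigcupT_measurable => k; apply: sub_sigma_algebra; eexists.
  apply/seteqP; split => v; rewrite /f/= ?in_itv/=.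
    move=> vx; have : setT v by []; rewrite -cover => -[k _ vk]; exists k => // l.
    by case: eqP => [->//|_]; exact: vk.
  by move=> [k _ /(_ i)]; rewrite eqxx.
- move=> _ _ [a _ <-] [b _ <-]; exists (fun i => Num.min (a i) (b i)) => //.
  apply/seteqP; split => [v H|v [H1 H2] i]; last by rewrite lt_min H1 H2.
  by split => i; have := H i; rewrite lt_min => /andP[].
- by move=> k; exists (fun=> k%:R).
- exact: cover.
- by move=> _ [a _ <-].
- move=> k; apply: le_lt_trans fin1; apply: le_measure; rewrite ?inE//.
  exact: measurable_lower_box.
Qed.

End box_uniqueness.

Section bounded_determinacy.
Context {R : realType} d1 d2 (T1 : measurableType d1) (T2 : measurableType d2)
  (P1 : probability T1 R) (P2 : probability T2 R) (d : nat).

(** The affine map sends a to the threshold 1/2 and [-B, B] into [0, 1], because |x - a| <= B + |a|;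
    the extra 1 keeps the denominator positive. *)
Definition step_poly (B a : R) (N : nat) : {poly R} :=
  let l := (2 * (B + `|a| + 1))^-1 in
  (1 - (l *: ('X - a%:P) + (2^-1)%:P) ^+ N) ^+ (N * 2 ^ N).

Lemma step_poly_bounds (B a x : R) : 0 <= B -> `|x| <= B ->
  let l := (2 * (B + `|a| + 1))^-1 in
  0 <= l * (x - a) + 2^-1 <= 1 /\ (l * (x - a) + 2^-1 < 2^-1) = (x < a).
Proof.
move=> B0 xB l; have D0 : 0 < B + `|a| + 1 by rewrite ltr_wpDl// addr_ge0.
have l0 : 0 < l by rewrite invr_gt0 mulr_gt0.
split; last by rewrite gtrDr pmulr_rlt0// subr_lt0.
have h : `|l * (x - a)| <= 2^-1.
  rewrite normrM gtr0_norm// /l invfM -mulrA ler_piMr ?invr_ge0//.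
  rewrite mulrC ler_pdivrMr// mul1r (le_trans (ler_normB _ _))//.
  by rewrite (le_trans (lerD xB (lexx _)))// lerDl.
by move: h; rewrite ler_norml => /andP[]; lra.
Qed.

Lemma step_polyE (B a x : R) N : (step_poly B a N).[x] =
  (1 - ((2 * (B + `|a| + 1))^-1 * (x - a) + 2^-1) ^+ N) ^+ (N * 2 ^ N).
Proof. by rewrite /step_poly !hornerE. Qed.

Lemma step_poly_cvg (B a x : R) : 0 <= B -> `|x| <= B ->
  (fun N => (step_poly B a N).[x]) @ \oo --> ((x < a)%R%:R : R).
Proof.
move=> B0 xB; have [h <-] := step_poly_bounds a B0 xB.
under eq_fun do rewrite step_polyE.
exact: step_polynomial_cvg.
Qed.

Lemma step_poly_norm (B a x : R) N : 0 <= B -> `|x| <= B ->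
  `|(step_poly B a N).[x]| <= 1.
Proof.
move=> B0 xB; have [/andP[h0 h1] _] := step_poly_bounds a B0 xB.
rewrite step_polyE normrX exprn_ile1// ger0_norm ?subr_ge0 ?exprn_ile1//.
by rewrite gerBl exprn_ge0.
Qed.

Lemma bounded_tnth d' (T : measurableType d') (Z : T -> Rvec R d) (B : R) (k : nat) :
  measurable_fun setT Z -> (forall w i, `|tnth (Z w) i : R| <= B) -> 0 <= B ->
  measurable_fun setT (fun w => nth 0 (Z w) k : R) /\ forall w, `|nth 0 (Z w) k : R| <= B.
Proof.
move=> mZ ZB B0; have [kd|kd] := ltnP k d; last first.
  have E w : nth 0 (Z w) k = 0 by rewrite nth_default// size_tuple.
  split; last by move=> w; rewrite E normr0.
  by under eq_fun do rewrite E; exact: measurable_cst.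
have E w : nth 0 (Z w) k = tnth (Z w) (Ordinal kd) by rewrite (tnth_nth 0).
split; last by move=> w; rewrite E.
under eq_fun do rewrite E.
apply: (measurableT_comp (f := fun v : Rvec R d => tnth v (Ordinal kd))) => //.
exact: measurable_tnth.
Qed.

(** Dominated convergence with bound 1. The limit holds at every point, even on the faces of the
    box: at the threshold it is 0, in accordance with the strict inequalities. *)
Lemma prod_step_cvg d' (T : measurableType d') (P : probability T R)
    (Z : T -> Rvec R d) (B : R) (a : 'I_d -> R) (a' : nat -> R) :
  (forall i : 'I_d, a' i = a i) ->
  measurable_fun setT Z -> (forall w i, `|tnth (Z w) i : R| <= B) -> 0 <= B ->
  (fun N => (\int[P]_w (\prod_(k < d) (step_poly B (a' k) N).[nth 0 (Z w) k])%:E)%E)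
    @ \oo --> P (Z @^-1` lower_box a).
Proof.
move=> aE mZ ZB B0.
have mA : measurable (Z @^-1` lower_box a).
  by rewrite -[X in measurable X]setTI; apply: mZ => //; exact: measurable_lower_box.
have mf N : measurable_fun setT
    (fun w => (\prod_(k < d) (step_poly B (a' k) N).[nth 0 (Z w) k])%:E).
  apply/measurable_EFinP; apply: measurable_prod => k _.
  under eq_fun do rewrite step_polyE.
  apply: measurable_funX; apply: measurable_funB => //; apply: measurable_funX.
  apply: measurable_funD => //; apply: measurable_funM => //; apply: measurable_funB => //.
  by have [] := bounded_tnth k mZ ZB B0.
have mi : measurable_fun setT (fun w => (\1_(Z @^-1` lower_box a) w : R)%:E).
  by apply/measurable_EFinP; exact: measurable_indic.
have cf : {ae P, forall w, setT w ->
    (fun N => (\prod_(k < d) (step_poly B (a' k) N).[nth 0 (Z w) k])%:E) @ \oo -->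
    (\1_(Z @^-1` lower_box a) w : R)%:E}.
  apply: aeW => w _; apply: cvg_EFin; first exact: nearW.
  have -> : \1_(Z @^-1` lower_box a) w = \prod_(k < d) ((nth 0 (Z w) k < a' k)%R%:R : R).
    rewrite indicE; case: (boolP (w \in _)) => [|].
      rewrite inE => /= H; rewrite big1// => k _.
      by have := H k; rewrite (tnth_nth 0) aE => ->.
    rewrite notin_setE => /= H.
    have /existsNP[k /negP] := H.
    by rewrite (tnth_nth 0) => /negbTE Hk; rewrite (bigD1 k)//= aE Hk mul0r.
  apply: cvg_big => // [|k _]; first exact: mul_continuous.
  by apply: step_poly_cvg => //; have [_] := bounded_tnth k mZ ZB B0.
have dom : {ae P, forall w N, setT w ->
    (`|(\prod_(k < d) (step_poly B (a' k) N).[nth 0 (Z w) k])%:E| <= cst 1 w)%E}.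
  apply: aeW => w N _ /=; rewrite lee_fin normr_prod.
  apply: prodr_ile1 => k; rewrite normr_ge0 step_poly_norm//.
  by have [_] := bounded_tnth k mZ ZB B0.
have [_ _] := dominated_convergence measurableT mf mi cf
  (finite_measure_integrable_cst P 1 measurableT) dom.
by rewrite integral_indic// setIT.
Qed.

Lemma bounded_moment_determinacy (B : R) (Z1 : T1 -> Rvec R d) (Z2 : T2 -> Rvec R d) :
  measurable_fun setT Z1 -> measurable_fun setT Z2 ->
  (forall w i, `|tnth (Z1 w) i : R| <= B) -> (forall w i, `|tnth (Z2 w) i : R| <= B) ->
  0 <= B ->
  (forall (xi : 'I_d -> R) p,
    \int[P1]_w ((\sum_(i < d) xi i * (tnth (Z1 w) i : R)) ^+ p) =
    \int[P2]_w ((\sum_(i < d) xi i * (tnth (Z2 w) i : R)) ^+ p)) ->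
  forall A, measurable A -> P1 (Z1 @^-1` A) = P2 (Z2 @^-1` A).
Proof.
move=> m1 m2 b1 b2 B0 H.
pose u1 k w : R := nth 0 (Z1 w) k.
pose u2 k w : R := nth 0 (Z2 w) k.
have bu1 k : bounded_measurable (u1 k).
  by have [? ?] := bounded_tnth k m1 b1 B0; split => //; exists B.
have bu2 k : bounded_measurable (u2 k).
  by have [? ?] := bounded_tnth k m2 b2 B0; split => //; exists B.
have S1 : forall Q : nat -> {poly R},
    same_mean P1 P2 (fun w => 1 * \prod_(k < d) (Q k).[u1 k w])
                    (fun w => 1 * \prod_(k < d) (Q k).[u2 k w]).
  apply: same_mean_polys => //; try exact: bounded_measurable_cst.
  apply: same_mean_monomials => //; try exact: bounded_measurable_cst.
  move=> xi p; rewrite /same_mean.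
  have := H (fun i => xi i) p.
  have E d' (T : measurableType d') (P : probability T R) (Z : T -> Rvec R d) :
    \int[P]_w ((\sum_(i < d) xi i * (tnth (Z w) i : R)) ^+ p) =
    \int[P]_w (1 * (\sum_(i < d) xi i * (nth 0 (Z w) i : R)) ^+ p).
    apply: eq_Rintegral => w _; rewrite mul1r; congr (_ ^+ _).
    by apply: eq_bigr => i _; rewrite (tnth_nth 0).
  by rewrite !E.
move=> A mA.
pose q1 := measure_function_pushforward__canonical__measure_function_Measure P1 m1.
pose q2 := measure_function_pushforward__canonical__measure_function_Measure P2 m2.
apply: (@lower_box_measure_unique _ _ q1 q2) => //.
  by rewrite /q1/= /pushforward preimage_setT [P1 _]probability_setT ltry.
move=> a; rewrite /q1 /q2/= /pushforward.
pose a' (k : nat) : R := if insub k is Some i then a i else 0.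
have aE (i : 'I_d) : a' i = a i by rewrite /a' valK.
have c1 := prod_step_cvg (P := P1) aE m1 b1 B0.
have c2 := prod_step_cvg (P := P2) aE m2 b2 B0.
apply: (cvg_unique _ c1) => //.
rewrite (_ : (fun N => _) = (fun N => (\int[P2]_w (\prod_(k < d) (step_poly B (a' k) N).[nth 0 (Z2 w) k])%:E)%E))//.
apply/funext => N.
have := S1 (fun k => step_poly B (a' k) N); rewrite /same_mean.
under eq_Rintegral do rewrite mul1r.
under [in RHS]eq_Rintegral do rewrite mul1r.
have fin d' (T : measurableType d') (P : probability T R) (Z : T -> Rvec R d) :
    measurable_fun setT Z -> (forall w i, `|tnth (Z w) i : R| <= B) ->
    (\int[P]_w (\prod_(k < d) (step_poly B (a' k) N).[nth 0 (Z w) k])%:E)%E \is a fin_num.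
  move=> mZ bZ; apply: integrable_fin_num => //.
  apply: (@bounded_measurable_integrable _ _ _ P (fun w => \prod_(k < d) (step_poly B (a' k) N).[nth 0 (Z w) k])).
  split; last first.
    exists 1 => w; rewrite normr_prod; apply: prodr_ile1 => k.
    by rewrite normr_ge0 step_poly_norm//; have [_] := bounded_tnth k mZ bZ B0.
  apply: measurable_prod => k _.
  under eq_fun do rewrite step_polyE.
  apply: measurable_funX; apply: measurable_funB => //; apply: measurable_funX.
  apply: measurable_funD => //; apply: measurable_funM => //; apply: measurable_funB => //.
  by have [] := bounded_tnth k mZ bZ B0.
by move=> E; rewrite -(fineK (fin _ _ P1 Z1 m1 b1)) -(fineK (fin _ _ P2 Z2 m2 b2)); congr EFin.
Qed.

End bounded_determinacy.

(** * The uniform law on the sphere *)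

Section uniform_sphere.
Context {R : realType} (d : nat).

(* Killing the exceptional null sets makes all the functions integrated below
   bounded everywhere. *)
Definition clamp_sphere (v : Rvec R d) : Rvec R d :=
  [tuple (tnth v i : R) * \1_(unit_sphere d) v | i < d].

Lemma measurable_unit_sphere : measurable (unit_sphere d : set (Rvec R d)).
Proof.
rewrite (_ : unit_sphere d = (fun v : Rvec R d => \sum_(i < d) (tnth v i : R) ^+ 2) @^-1` [set 1])//.
rewrite -[X in measurable X]setTI.
apply: (measurable_sum (index_enum 'I_d) (h := fun i (v : Rvec R d) => (tnth v i : R) ^+ 2)) => //.
by move=> i; apply: measurable_funX; exact: measurable_tnth.
Qed.

Lemma measurable_clamp_sphere : measurable_fun setT clamp_sphere.
Proof.
apply/measurable_fun_tnthP => i.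
rewrite (_ : _ \o _ = fun v : Rvec R d => (tnth v i : R) * \1_(unit_sphere d) v).
  apply: measurable_funM; first exact: measurable_tnth.
  by apply: measurable_indic; exact: measurable_unit_sphere.
by apply/funext => v /=; rewrite tnth_mktuple.
Qed.

Lemma sum_sqr_clamp_sphere v :
  \sum_(i < d) (tnth (clamp_sphere v) i : R) ^+ 2 = \1_(unit_sphere d) v.
Proof.
under eq_bigr do rewrite tnth_mktuple exprMn.
rewrite -big_distrl/= indicE; case: (boolP (v \in _)) => [|_] /=.
  by rewrite inE /unit_sphere/= => ->; rewrite mul1r expr1n.
by rewrite expr2 !mulr0.
Qed.

Lemma clamp_sphere_le1 v i : `|tnth (clamp_sphere v) i : R| <= 1.
Proof.
rewrite -(@expr_le1 _ 2)// -normrX ger0_norm ?sqr_ge0//.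
apply: (@le_trans _ _ (\sum_(i < d) (tnth (clamp_sphere v) i : R) ^+ 2)).
  by rewrite (bigD1 i)//= lerDl; apply: sumr_ge0 => *; exact: sqr_ge0.
by rewrite sum_sqr_clamp_sphere indicE; case: (_ \in _).
Qed.

Definition proj_sphere (xi : 'rV[R]_d) (v : Rvec R d) : R :=
  \sum_(i < d) xi 0 i * (tnth (clamp_sphere v) i : R).

Lemma bounded_measurable_clamp i :
  bounded_measurable (fun v => tnth (clamp_sphere v) i : R).
Proof.
split; last by exists 1 => v; exact: clamp_sphere_le1.
apply: (measurableT_comp (f := fun v : Rvec R d => tnth v i)); first exact: measurable_tnth.
exact: measurable_clamp_sphere.
Qed.

Lemma bounded_measurable_proj xi : bounded_measurable (proj_sphere xi).
Proof.
apply: bounded_measurable_sum => i; apply: bounded_measurableM.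
  exact: bounded_measurable_cst.
exact: bounded_measurable_clamp.
Qed.

Variable mu : probability (Rvec R d) R.
Hypothesis umu : uniform_on_sphere mu.

Lemma measurable_mulmx_tuple (Q : 'M[R]_d) :
  measurable_fun setT (mulmx_tuple Q : Rvec R d -> Rvec R d).
Proof.
apply/measurable_fun_tnthP => i.
rewrite (_ : _ \o _ = fun v : Rvec R d => \sum_(l < d) Q i l * (tnth v l : R)).
  by apply: measurable_sum => l; apply: measurable_funM => //; exact: measurable_tnth.
by apply/funext => v /=; rewrite tnth_mktuple.
Qed.

Lemma Rintegral_mulmx_tuple (Q : 'M[R]_d) (f : Rvec R d -> R) :
  Q *m Q^T = 1%:M -> bounded_measurable f ->
  \int[mu]_v f (mulmx_tuple Q v) = \int[mu]_v f v.
Proof.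
move=> QQ bf; rewrite /Rintegral; congr fine.
have mQ := measurable_mulmx_tuple Q.
pose q := measure_function_pushforward__canonical__measure_function_Measure mu mQ.
have -> : (\int[mu]_v (f v)%:E = \int[q]_v (f v)%:E)%E.
  by apply: eq_measure_integral => A mA _; rewrite /q/= /pushforward umu.2.
rewrite integral_pushforward//; first by apply/measurable_EFinP; have [] := bf.
apply: (@bounded_measurable_integrable _ _ _ mu (f \o mulmx_tuple Q)).
have [mf [B fB]] := bf; split; first exact: measurableT_comp.
by exists B => v; exact: fB.
Qed.

Lemma clamp_sphere_mulmx (Q : 'M[R]_d) v : Q *m Q^T = 1%:M ->
  clamp_sphere (mulmx_tuple Q v) = mulmx_tuple Q (clamp_sphere v).
Proof.
move=> QQ; apply: eq_from_tnth => i; rewrite !tnth_mktuple big_distrl/=.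
have -> : \1_(unit_sphere d) (mulmx_tuple Q v) = \1_(unit_sphere d) v :> R.
  rewrite !indicE; congr (_%:R); congr nat_of_bool.
  have E : \sum_(i < d) (tnth (mulmx_tuple Q v) i : R) ^+ 2 = \sum_(i < d) (tnth v i : R) ^+ 2.
    pose w : 'cV[R]_d := \col_i (tnth v i : R).
    have nE (z : 'cV[R]_d) : \sum_(i < d) z i 0 ^+ 2 = (z^T *m z) 0 0.
      by rewrite mxE; apply: eq_bigr => k _; rewrite mxE expr2.
    transitivity (\sum_(i < d) (Q *m w) i 0 ^+ 2).
      apply: eq_bigr => k _; rewrite tnth_mktuple mxE; congr (_ ^+ 2).
      by apply: eq_bigr => l _; rewrite mxE.
    rewrite nE trmx_mul mulmxA -[_ *m Q]mulmxA (mulmx1C QQ) mulmx1 -nE.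
    by apply: eq_bigr => k _; rewrite mxE.
  by apply/idP/idP; rewrite !inE /unit_sphere/= E.
by apply: eq_bigr => l _; rewrite tnth_mktuple mulrA.
Qed.

Lemma proj_sphere_mulmx (Q : 'M[R]_d) xi v : Q *m Q^T = 1%:M ->
  proj_sphere xi (mulmx_tuple Q v) = proj_sphere (xi *m Q) v.
Proof.
move=> QQ; rewrite /proj_sphere clamp_sphere_mulmx//.
under eq_bigr do rewrite tnth_mktuple big_distrr/=.
rewrite exchange_big/=; apply: eq_bigr => l _.
by rewrite mxE big_distrl/=; apply: eq_bigr => i _; rewrite mulrA.
Qed.

Lemma proj_moment_mulmx (Q : 'M[R]_d) xi p : Q *m Q^T = 1%:M ->
  \int[mu]_v (proj_sphere xi v ^+ p) = \int[mu]_v (proj_sphere (xi *m Q) v ^+ p).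
Proof.
move=> QQ; rewrite -(Rintegral_mulmx_tuple QQ).
  by apply: eq_Rintegral => v _; rewrite proj_sphere_mulmx.
by apply: bounded_measurableX; exact: bounded_measurable_proj.
Qed.

(** Q is the reflection that exchanges xi and r e. The sign of r is free, and r = -1 is used for the
    odd moments. *)
Lemma householder (xi : 'rV[R]_d) (i0 : 'I_d) (r : R) :
  (xi *m xi^T) 0 0 = r ^+ 2 ->
  exists Q : 'M[R]_d, Q *m Q^T = 1%:M /\ xi *m Q = r *: delta_mx 0 i0.
Proof.
move=> xir; pose e : 'rV[R]_d := delta_mx 0 i0.
have [->|xie] := eqVneq xi (r *: e).
  by exists 1%:M; rewrite trmx1 !mulmx1.
pose u := xi - r *: e; pose s := (u *m u^T) 0 0.
have ee : e *m e^T = 1%:M.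
  by rewrite trmx_delta mul_delta_mx; apply/matrixP => i j; rewrite !mxE !ord1 !eqxx.
have xiT : xi *m xi^T = (r ^+ 2)%:M.
  by apply/matrixP => i j; rewrite !ord1 xir !mxE eqxx.
have uu : u *m u^T = s%:M by apply/matrixP => i j; rewrite !ord1 [RHS]mxE eqxx.
have s0 : s != 0.
  have : u != 0 by rewrite subr_eq0.
  apply: contra_neq => s0; apply/matrixP => i j; rewrite ord1 [RHS]mxE.
  have : \sum_k u 0 k ^+ 2 = 0.
    rewrite -[RHS]s0 /s [RHS]mxE; apply: eq_bigr => k _.
    by rewrite [u^T _ _]mxE expr2.
  move/eqP; rewrite psumr_eq0; last by move=> k _; exact: sqr_ge0.
  by move=> /allP/(_ j (mem_index_enum j)); rewrite sqrf_eq0 => /eqP.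
have xe : e *m xi^T = xi *m e^T.
  apply/matrixP => i j; rewrite !ord1 [LHS]mxE [RHS]mxE; apply: eq_bigr => k _.
  by rewrite [xi^T _ _]mxE [e^T _ _]mxE mulrC.
have uT : u^T = xi^T - r *: e^T by rewrite /u linearB/= linearZ.
(* Because xi and r e have the same norm, |u|^2 = 2 <xi, u>. *)
have sE : s%:M = 2 *: (xi *m u^T).
  rewrite -uu uT [in X in X = _]/u mulmxBl !mulmxBr -!scalemxAl -!scalemxAr ee xe xiT.
  by apply/matrixP => i j; rewrite !ord1 !mxE eqxx; ring.
pose Q := 1%:M - (2 / s) *: (u^T *m u).
have QT : Q^T = Q by rewrite /Q linearB linearZ/= trmx1 trmx_mul trmxK.
exists Q; split.
  have NN : (u^T *m u) *m (u^T *m u) = s *: (u^T *m u).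
    by rewrite mulmxA -[u^T *m u *m u^T]mulmxA uu mul_mx_scalar scalemxAl.
  rewrite QT /Q mulmxBr mulmx1 mulmxBl mul1mx -scalemxAl -scalemxAr NN.
  by rewrite !scalerA; apply/matrixP => i j; rewrite !mxE; field.
rewrite /Q mulmxBr mulmx1 -scalemxAr mulmxA.
have -> : xi *m u^T = (s / 2)%:M.
  by rewrite -scalemx1 mulrC -scalerA scalemx1 sE scalerA mulVf ?scale1r.
rewrite mul_scalar_mx scalerA (_ : 2 / s * (s / 2) = 1); last by field.
by rewrite scale1r /u opprB addrC subrK.
Qed.


Lemma proj_sphereZ (r : R) xi v : proj_sphere (r *: xi) v = r * proj_sphere xi v.
Proof. by rewrite /proj_sphere big_distrr/=; apply: eq_bigr => i _; rewrite mxE mulrA. Qed.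

Lemma proj_sphereD xi xi' v : proj_sphere (xi + xi') v = proj_sphere xi v + proj_sphere xi' v.
Proof. by rewrite /proj_sphere -big_split/=; apply: eq_bigr => i _; rewrite mxE mulrDl. Qed.

Lemma proj_sphere_delta i v : proj_sphere (delta_mx 0 i) v = tnth (clamp_sphere v) i.
Proof.
rewrite /proj_sphere (bigD1 i)//= !mxE !eqxx mul1r big1 ?addr0// => k ki.
by rewrite mxE (negbTE ki) andbF mul0r.
Qed.

Lemma proj_moment_norm xi i0 (r : R) p : (xi *m xi^T) 0 0 = r ^+ 2 ->
  \int[mu]_v (proj_sphere xi v ^+ p) =
  r ^+ p * \int[mu]_v ((tnth (clamp_sphere v) i0 : R) ^+ p).
Proof.
move=> /(@householder xi i0 r)[Q [QQ xiQ]].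
rewrite (proj_moment_mulmx _ _ QQ) xiQ.
under eq_Rintegral do rewrite proj_sphereZ exprMn proj_sphere_delta.
by rewrite RintegralZ_bounded//; apply: bounded_measurableX; exact: bounded_measurable_clamp.
Qed.

(** A basis vector also satisfies the norm condition with r = -1, so its moment equals its own
    negative. *)
Lemma clamp_moment_odd i0 p : odd p ->
  \int[mu]_v ((tnth (clamp_sphere v) i0 : R) ^+ p) = 0.
Proof.
move=> op; have E := @proj_moment_norm (delta_mx 0 i0) i0 (-1) p.
have : \int[mu]_v (proj_sphere (delta_mx 0 i0) v ^+ p) =
       \int[mu]_v ((tnth (clamp_sphere v) i0 : R) ^+ p).
  by apply: eq_Rintegral => v _; rewrite proj_sphere_delta.
rewrite E; last by rewrite trmx_delta mul_delta_mx mxE !eqxx sqrrN expr1n.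
by rewrite -signr_odd op expr1 mulN1r => /eqP; rewrite eqNr => /eqP.
Qed.

(* Compare the coefficients of [s^2] in the moment of order [2p+2] of the
   projection on the direction [e_0 + s e_i]. *)
Lemma clamp_moment_mixed i0 i p : i != i0 ->
  (2 * p + 1)%:R * \int[mu]_v ((tnth (clamp_sphere v) i0 : R) ^+ (2 * p) *
                               (tnth (clamp_sphere v) i : R) ^+ 2) =
  \int[mu]_v ((tnth (clamp_sphere v) i0 : R) ^+ (2 * p.+1)).
Proof.
move=> ii0; set m := RHS; pose N := (2 * p.+1)%N.
pose x v : R := tnth (clamp_sphere v) i0; pose y v : R := tnth (clamp_sphere v) i.
pose c l := \int[mu]_v (x v ^+ (N - l) * y v ^+ l).
have bc (l : nat) : bounded_measurable (fun v => x v ^+ (N - l) * y v ^+ l).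
  by apply: bounded_measurableM; apply: bounded_measurableX; exact: bounded_measurable_clamp.
have key : \poly_(l < N.+1) (c l *+ 'C(N, l)) = m *: (1 + 'X^2) ^+ p.+1.
  apply/eqP; rewrite -subr_eq0; apply/eqP; apply: poly_nat_roots0 => n0; move: (n0%:R : R) => s.
  rewrite hornerD hornerN hornerZ !hornerE horner_poly.
  apply/eqP; rewrite subr_eq0; apply/eqP.
  pose xi : 'rV[R]_d := delta_mx 0 i0 + s *: delta_mx 0 i.
  have xixi : (xi *m xi^T) 0 0 = Num.sqrt (1 + s ^+ 2) ^+ 2.
    rewrite sqr_sqrtr ?addr_ge0 ?sqr_ge0// /xi linearD/= linearZ/= !trmx_delta.
    rewrite mulmxDl !mulmxDr -!scalemxAl -!scalemxAr !mul_delta_mx_cond.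
    by rewrite [i0 == i]eq_sym (negbTE ii0) !eqxx !mxE !eqxx/=; ring.
  have := proj_moment_norm i0 N xixi.
  rewrite -/m /N exprM sqr_sqrtr ?addr_ge0 ?sqr_ge0// [RHS]mulrC => <-.
  transitivity (\int[mu]_v (\sum_(l < N.+1) ('C(N, l)%:R * s ^+ l) * (x v ^+ (N - l) * y v ^+ l))).
    rewrite (Rintegral_sum mu); last first.
      by move=> l; apply: bounded_measurableM => //; exact: bounded_measurable_cst.
    by apply: eq_bigr => l _; rewrite RintegralZ_bounded// -[_ *+ 'C(N, l)]mulr_natl /c; ring.
  apply: eq_Rintegral => v _.
  rewrite proj_sphereD proj_sphereZ !proj_sphere_delta exprDn.
  by apply: eq_bigr => l _; rewrite exprMn -[_ *+ 'C(N, l)]mulr_natl /x /y; ring.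
have := congr1 (fun q : {poly R} => q`_2) key.
rewrite coef_poly ifT; last by rewrite /N; lia.
rewrite coefZ.
have [_ ->] : ((1 + 'X^2 : {poly R}) ^+ p.+1)`_0 = 1 /\
    ((1 + 'X^2 : {poly R}) ^+ p.+1)`_2 = p.+1%:R.
  elim: p.+1 => [|n [IH0 IH2]]; first by rewrite expr0 !coef1.
  by rewrite exprS mulrDl mul1r !coefD !coefXnM /= IH0 IH2 -natr1 addr0.
rewrite /c (_ : (N - 2)%N = (2 * p)%N); last by rewrite /N; lia.
rewrite -[_ *+ 'C(N, 2)]mulr_natl (_ : 'C(N, 2) = (p.+1 * (2 * p + 1))%N); last first.
  by rewrite bin2 /N; nia.
rewrite natrM -mulrA [m * _]mulrC => /mulfI; apply.
by rewrite pnatr_eq0.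
Qed.

(** Inserting the sum of the squares of the coordinates, which is 1, expresses the moment of order
    2p by mixed moments, and so (2p+1) m_(2p) = (2p+d) m_(2p+2). *)
Lemma clamp_moment_double i0 p :
  \int[mu]_v ((tnth (clamp_sphere v) i0 : R) ^+ (2 * p)) =
  poch 2^-1 p / poch (d%:R / 2) p.
Proof.
have d_gt0 : 0 < d%:R / 2 :> R.
  by rewrite divr_gt0// ltr0n; case: i0 => i; exact: leq_ltn_trans.
elim: p => [|p IH].
  under eq_Rintegral do rewrite muln0 expr0.
  by rewrite Rintegral_probability_cst !poch0 divr1.
set m := LHS.
suff E : (2 * p + 1)%:R * (poch 2^-1 p / poch (d%:R / 2) p) = (2 * p + d)%:R * m.
  have -> : m = (2 * p + 1)%:R / (2 * p + d)%:R * (poch 2^-1 p / poch (d%:R / 2) p).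
    rewrite mulrAC E mulrAC mulfV ?mul1r// pnatr_eq0.
    by have := ltn_ord i0; lia.
  have p0 : 0 <= p%:R :> R by [].
  rewrite !pochS (natrD _ (2 * p) 1) (natrD _ (2 * p) d) (natrM _ 2 p); field.
  have n2 : d%:R + p%:R * 2 != 0 :> R by rewrite gt_eqF//; lra.
  by rewrite n2 gt_eqF// poch_gt0.
rewrite -IH.
pose x v (i : 'I_d) : R := tnth (clamp_sphere v) i.
have bx (i : 'I_d) : bounded_measurable (fun v => x v i0 ^+ (2 * p) * x v i ^+ 2).
  by apply: bounded_measurableM; apply: bounded_measurableX; exact: bounded_measurable_clamp.
have -> : \int[mu]_v (x v i0 ^+ (2 * p)) =
    \int[mu]_v (\sum_(i < d) x v i0 ^+ (2 * p) * x v i ^+ 2).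
  (* For p = 0 the clamped norm is an indicator, and the sphere must have full measure; for p > 0
     both sides vanish off the sphere. *)
  case: p {IH m bx} => [|p].
    under eq_Rintegral do rewrite muln0 expr0.
    under [RHS]eq_Rintegral.
      move=> v _; under eq_bigr do rewrite muln0 expr0 mul1r.
      rewrite sum_sqr_clamp_sphere; over.
    rewrite Rintegral_probability_cst /Rintegral integral_indic//; last exact: measurable_unit_sphere.
    by rewrite setIT [X in fine X]umu.1.
  apply: eq_Rintegral => v _; rewrite -big_distrr/= sum_sqr_clamp_sphere indicE.
  case: (boolP (v \in _)) => vS /=; first by rewrite mulr1.
  by rewrite mulr0 /x tnth_mktuple indicE (negbTE vS) mulr0 expr0n.
rewrite (Rintegral_sum mu)// (bigD1 i0)//= mulrDr big_distrr/=.
have -> : \int[mu]_v (x v i0 ^+ (2 * p) * x v i0 ^+ 2) = m.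
  by apply: eq_Rintegral => v _; rewrite -exprD; congr (_ ^+ _); lia.
rewrite (eq_bigr (fun=> m)); last by move=> i ii0; rewrite clamp_moment_mixed.
rewrite sumr_const (_ : #|_| = d.-1); last first.
  by rewrite (@eq_card _ _ (predC1 i0))// cardC1 card_ord.
rewrite -[m *+ _]mulr_natl -mulrDl -natrD; congr (_%:R * _).
by have := ltn_ord i0; lia.
Qed.

Lemma proj_moment xi (r : R) p : (0 < d)%N -> (xi *m xi^T) 0 0 = r ^+ 2 ->
  \int[mu]_v (proj_sphere xi v ^+ p) = r ^+ p * sphere_moment (d%:R / 2) p.
Proof.
move=> d0 xir; rewrite (proj_moment_norm (Ordinal d0) _ xir); congr (_ * _).
rewrite /sphere_moment; case: ifP => op; first exact: clamp_moment_odd.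
have {1}-> : p = (2 * p./2)%N by lia.
exact: clamp_moment_double.
Qed.

End uniform_sphere.

(** * Independence *)

Section tuple_measure.
Context {R : realType} d (T : measurableType d) (n : nat).

Definition box (A : 'I_n -> set T) : set (n.-tuple T) :=
  [set v | forall i, A i (tnth v i)].

Lemma measurable_box A : (forall i, measurable (A i)) -> measurable (box A).
Proof.
move=> mA; rewrite (_ : box A = \bigcap_(i in [set: 'I_n]) ((fun v : n.-tuple T => tnth v i) @^-1` A i)).
  apply: fin_bigcap_measurable; first exact: finite_finset.
  by move=> i _; rewrite -[X in measurable X]setTI; apply: measurable_tnth.
by apply/seteqP; split => v H i; have := H i => //; apply.
Qed.

Lemma box_measure_unique (m1 m2 : {measure set (n.-tuple T) -> \bar R}) :
  (m1 setT < +oo)%E ->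
  (forall A, (forall i, measurable (A i)) -> m1 (box A) = m2 (box A)) ->
  forall A, measurable A -> m1 A = m2 A.
Proof.
move=> fin1 m12.
pose G := [set box A | A in [set A | forall i, measurable (A i)]].
have boxT : box (fun=> setT) = setT by apply/seteqP; split.
have mG : G `<=` measurable by move=> _ [A mA <-]; exact: measurable_box.
apply: (measure_unique G (fun=> setT)).
- apply/seteqP; split; last first.
    apply: smallest_sub => //; exact: sigma_algebra_measurable.
  apply: smallest_sub; first exact: smallest_sigma_algebra.
  apply: (big_ind (fun S => S `<=` <<s G >>)) => //.
    by move=> S1 S2 S1G S2G; rewrite subUset.
  move=> i _ _ [B mB <-]; rewrite setTI; apply: sub_sigma_algebra.
  exists (fun k => if k == i then B else setT); first by move=> k /=; case: eqP.
  apply/seteqP; split => v /=; first by move=> /(_ i); rewrite eqxx.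
  by move=> vB k; case: eqP => [->|].
- move=> _ _ [A mA <-] [B mB <-]; exists (fun i => A i `&` B i).
    by move=> i; apply: measurableI.
  apply/seteqP; split => [v H|v [H1 H2] i]; last by split; [exact: H1|exact: H2].
  by split => i; have [] := H i.
- by move=> _; exists (fun=> setT).
- by apply/seteqP; split => // v _; exists 0%N.
- by move=> _ [A mA <-]; exact: m12.
- by [].
Qed.

End tuple_measure.

Section independence.
Context {R : realType} d (Omega : measurableType d) (P : probability Omega R).

(** The joint law is the product of the marginals by uniqueness on rectangles; Fubini does the
    rest. *)
Lemma indep_pair_mean d1 d2 (T1 : measurableType d1) (T2 : measurableType d2)
    (U : Omega -> T1) (V : Omega -> T2) (f : T1 -> R) (g : T2 -> R) :
  measurable_fun setT U -> measurable_fun setT V ->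
  (forall A B, measurable A -> measurable B ->
     P (U @^-1` A `&` V @^-1` B) = (P (U @^-1` A) * P (V @^-1` B))%E) ->
  bounded_measurable f -> bounded_measurable g ->
  \int[P]_w (f (U w) * g (V w)) = \int[P]_w f (U w) * \int[P]_w g (V w).
Proof.
move=> mU mV UV bf bg.
pose Um : {mfun Omega >-> T1} := HB.pack U (isMeasurableFun.Build _ _ _ _ U mU).
pose Vm : {mfun Omega >-> T2} := HB.pack V (isMeasurableFun.Build _ _ _ _ V mV).
have mW : measurable_fun setT (fun w => (U w, V w)) by apply/measurable_fun_pairP.
pose Wm : {mfun Omega >-> (T1 * T2)%type} := HB.pack (fun w => (U w, V w)) (isMeasurableFun.Build _ _ _ _ _ mW).
pose PU := distribution P Um; pose PV := distribution P Vm; pose PW := distribution P Wm.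
have prodE X : measurable X -> (PU \x PV)%E X = PW X.
  apply: product_measure_unique => A B mA mB.
  by rewrite /PW /PU /PV /distribution /pushforward/= -UV.
have tr d' (T : measurableType d') (Y : {mfun Omega >-> T}) (h : T -> R) :
    bounded_measurable h -> \int[P]_w h (Y w) = \int[distribution P Y]_y h y.
  move=> bh; rewrite /Rintegral; congr fine.
  rewrite integral_pushforward//; first by apply/measurable_EFinP; have [] := bh.
  apply: (@bounded_measurable_integrable _ _ _ P (h \o Y)).
  have [mh [B hB]] := bh; split; first exact: measurableT_comp.
  by exists B => w; exact: hB.
have bF : bounded_measurable (fun z : T1 * T2 => f z.1 * g z.2).
  apply: bounded_measurableM.
    by have [mf [B fB]] := bf; split; [exact: measurableT_comp|exists B => z].
  by have [mg [B gB]] := bg; split; [exact: measurableT_comp|exists B => z].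
rewrite (tr _ _ Wm (fun z => f z.1 * g z.2))// (tr _ _ Um f)// (tr _ _ Vm g)//.
rewrite -/PW -/PU -/PV.
have -> : \int[PW]_z (f z.1 * g z.2) = fine (\int[PU]_x \int[PV]_y (f x * g y)%:E)%E.
  rewrite /Rintegral; congr fine.
  rewrite (eq_measure_integral (PU \x PV)%E); last by move=> A mA _; exact: (esym (prodE A mA)).
  rewrite -integral12_prod_meas1//.
  apply/integrableP; split; first by apply/measurable_EFinP; have [] := bF.
  rewrite (eq_measure_integral PW); last by move=> A mA _; exact: prodE.
  by have /integrableP[] := @bounded_measurable_integrable _ _ _ PW _ bF.
have ig : PV.-integrable setT (EFin \o g) by exact: bounded_measurable_integrable.
have if_ : PU.-integrable setT (EFin \o f) by exact: bounded_measurable_integrable.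
under eq_integral.
  move=> x _; under eq_integral do rewrite EFinM.
  rewrite integralZl//.
  over.
have -> : (\int[PV]_y (g y)%:E)%E = (\int[PV]_y g y)%:E by rewrite fineK// integrable_fin_num.
by rewrite integralZr// fineM//= integrable_fin_num.
Qed.


Lemma independent_family_tail d' (T : measurableType d') m
    (Y : 'I_m.+1 -> Omega -> T) :
  (forall k, measurable_fun setT (Y k)) -> independent_family P Y ->
  independent_family P (fun k => Y (lift ord0 k)).
Proof.
move=> mY iY A mA.
pose A' (k : 'I_m.+1) := if unlift ord0 k is Some i then A i else setT.
have mA' k : measurable (A' k) by rewrite /A'; case: unlift.
have A'l k : A' (lift ord0 k) = A k by rewrite /A' liftK.
have A'0 : A' ord0 = setT by rewrite /A' unlift_none.
have := iY A' mA'; rewrite big_ord_recl A'0 preimage_setT probability_setT mul1e.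
under eq_bigr do rewrite A'l.
move=> <-; congr (P _); apply/seteqP; split => w H k _.
  by have [i ->|->] := unliftP ord0 k; rewrite ?A'l ?A'0//; exact: H.
by rewrite -A'l; exact: H.
Qed.

(** For fixed A both sides are finite measures in B that agree on boxes. *)
Lemma independent_family_head d' (T : measurableType d') m
    (Y : 'I_m.+1 -> Omega -> T) :
  (forall k, measurable_fun setT (Y k)) -> independent_family P Y ->
  forall A B, measurable A -> measurable B ->
    P (Y ord0 @^-1` A `&` (fun w => [tuple Y (lift ord0 k) w | k < m]) @^-1` B) =
    (P (Y ord0 @^-1` A) * P ((fun w => [tuple Y (lift ord0 k) w | k < m]) @^-1` B))%E.
Proof.
move=> mY iY A B mA mB; pose V w := [tuple Y (lift ord0 k) w | k < m].
have mV : measurable_fun setT V.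
  apply/measurable_fun_tnthP => k.
  rewrite (_ : _ \o _ = Y (lift ord0 k)); first exact: mY.
  by apply/funext => w /=; rewrite tnth_mktuple.
have mYA : measurable (Y ord0 @^-1` A) by rewrite -[X in measurable X]setTI; exact: mY.
pose q1 := measure_function_pushforward__canonical__measure_function_Measure (mrestr P mYA) mV.
have pYA : 0 <= fine (P (Y ord0 @^-1` A)) by rewrite fine_ge0.
pose q2 := mscale (NngNum pYA)
  (measure_function_pushforward__canonical__measure_function_Measure P mV).
have pE : (fine (P (Y ord0 @^-1` A)))%:E = P (Y ord0 @^-1` A).
  by rewrite fineK// fin_num_measure.
suff : q1 B = q2 B.
  rewrite /q1 /q2 /mscale/= /pushforward /mrestr pE => <-.
  by rewrite setIC.
apply: box_measure_unique => //.
  by rewrite /q1/= /pushforward /mrestr preimage_setT setTI -pE ltry.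
move=> C mC; rewrite /q1 /q2/= /mscale/= /pushforward /mrestr pE setIC.
have VC : V @^-1` box C = \bigcap_(k in [set: 'I_m]) (Y (lift ord0 k) @^-1` C k).
  apply/seteqP; split => w H k; first by move=> _; have := H k; rewrite tnth_mktuple.
  by rewrite tnth_mktuple; exact: H.
rewrite [in RHS]VC (independent_family_tail mY iY mC).
pose A' (k : 'I_m.+1) := if unlift ord0 k is Some i then C i else A.
have mA' k : measurable (A' k) by rewrite /A'; case: unlift.
have A'l k : A' (lift ord0 k) = C k by rewrite /A' liftK.
have A'0 : A' ord0 = A by rewrite /A' unlift_none.
have := iY A' mA'; rewrite big_ord_recl A'0.
under eq_bigr do rewrite A'l.
move=> <-; congr (P _); rewrite VC; apply/seteqP; split => [w [H0 H] k _|w H].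
  by have [i ->|->] := unliftP ord0 k; rewrite ?A'l ?A'0//; exact: H.
split; first by have := H ord0 Logic.I; rewrite A'0.
by move=> k _; have := H (lift ord0 k) Logic.I; rewrite A'l.
Qed.

(** The probabilistic meaning of [weighted_moment]: binomial expansion around the first variable,
    which is independent of the remaining sum. *)
Lemma weighted_moment_mean d' (T : measurableType d') m (Y : 'I_m -> Omega -> T)
    (g : T -> R) (mom : nat -> R) (c : m.-tuple R) p :
  (forall k, measurable_fun setT (Y k)) -> independent_family P Y ->
  bounded_measurable g ->
  (forall k q, \int[P]_w (g (Y k w) ^+ q) = mom q) ->
  \int[P]_w ((\sum_(k < m) g (Y k w) * tnth c k) ^+ p) = weighted_moment mom c p.
Proof.
move=> + + bg; elim: m Y c p => [|m IH] Y c p mY iY momE.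
  under eq_Rintegral do rewrite big_ord0 expr0n.
  by rewrite Rintegral_probability_cst (tuple0 c).
have [x [c' ->]] : exists (x : R) (c' : m.-tuple R), c = [tuple of x :: c'].
  by exists (thead c), [tuple of behead c]; exact: tuple_eta.
pose V w := [tuple Y (lift ord0 k) w | k < m].
have mV : measurable_fun setT V.
  apply/measurable_fun_tnthP => k.
  rewrite (_ : _ \o _ = Y (lift ord0 k)); first exact: mY.
  by apply/funext => w /=; rewrite tnth_mktuple.
pose S (v : m.-tuple T) := \sum_(k < m) g (tnth v k) * tnth c' k.
have bS : bounded_measurable S.
  apply: bounded_measurable_sum => k; apply: bounded_measurableM; last exact: bounded_measurable_cst.
  have [mg [B gB]] := bg; split; last by exists B => v.
  by apply: (measurableT_comp (f := g)) => //; exact: measurable_tnth.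
have SV w : S (V w) = \sum_(k < m) g (Y (lift ord0 k) w) * tnth c' k.
  by apply: eq_bigr => k _; rewrite tnth_mktuple.
have bcomp d2 (T2 : measurableType d2) (U : Omega -> T2) (h : T2 -> R) :
    measurable_fun setT U -> bounded_measurable h -> bounded_measurable (fun w => h (U w)).
  by move=> mU [mh [B hB]]; split; [exact: measurableT_comp|exists B => w].
transitivity (\int[P]_w (\sum_(q < p.+1) ('C(p, q)%:R * x ^+ q) *
    (g (Y ord0 w) ^+ q * S (V w) ^+ (p - q)))).
  apply: eq_Rintegral => w _; rewrite big_ord_recl tnth0 addrC.
  under eq_bigr do rewrite tnthS.
  rewrite -SV exprDn; apply: eq_bigr => q _.
  by rewrite exprMn -[_ *+ 'C(p, q)]mulr_natl; ring.
have bq (q : nat) : bounded_measurable (fun w => g (Y ord0 w) ^+ q * S (V w) ^+ (p - q)).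
  by apply: bounded_measurableM; apply: bounded_measurableX; apply: bcomp.
rewrite (Rintegral_sum P); last first.
  by move=> q; apply: bounded_measurableM => //; exact: bounded_measurable_cst.
rewrite /=; apply: eq_bigr => q _; rewrite RintegralZ_bounded//.
rewrite (@indep_pair_mean _ _ _ _ (Y ord0) V (fun y => g y ^+ q) (fun v => S v ^+ (p - q)))//; first last.
- exact: bounded_measurableX.
- exact: bounded_measurableX.
- exact: independent_family_head.
rewrite momE -(IH (fun k => Y (lift ord0 k)) c' (p - q)%N)//.
- under [in RHS]eq_Rintegral do rewrite -SV.
  by ring.
- exact: independent_family_tail.
Qed.

End independence.

(** * Integration against a density *)

Section density.
Context {R : realType} d (T : measurableType d).
Variables (nu la : {measure set T -> \bar R}) (w : T -> R).
Hypotheses (mw : measurable_fun setT w) (w0 : forall x, 0 <= w x).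
Hypothesis nuE : forall A, measurable A -> (nu A = \int[la]_(x in A) (w x)%:E)%E.

Import HBNNSimple.

Let integral_density_nnsfun (h : {nnsfun T >-> R}) :
  (\int[nu]_x (h x)%:E = \int[la]_x ((h x)%:E * (w x)%:E))%E.
Proof.
have mh r : measurable (h @^-1` [set r]) by [].
under eq_integral do rewrite fimfunE -fsumEFin//.
rewrite ge0_integral_fsum//; last 2 first.
- by move=> r; exact/measurable_EFinP/measurableT_comp.
- by move=> n x _; rewrite EFinM nnfun_muleindic_ge0.
under [RHS]eq_integral.
  move=> x _; rewrite fimfunE -fsumEFin// ge0_mule_fsuml; last first.
    by move=> r; rewrite EFinM nnfun_muleindic_ge0.
  over.
rewrite [RHS]ge0_integral_fsum//; last 2 first.
- move=> r; apply: emeasurable_funM; last exact/measurable_EFinP.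
  by apply/measurable_EFinP; apply: measurable_funM => //; exact: measurable_indic.
- by move=> n x _; rewrite EFinM mule_ge0 ?nnfun_muleindic_ge0 ?lee_fin.
apply: eq_fsbigr => r _.
rewrite integralZl_indic_nnsfun// integral_indic// setIT nuE//.
have [r0|r0] := ltP r 0.
  rewrite (preimage_nnfun0 _ r0) integral_set0 mule0; apply/esym/integral0_eq => x _.
  by rewrite indicE in_set0 mulr0 mul0e.
rewrite -ge0_integralZl//; last 2 first.
- by apply/measurable_EFinP; exact: measurable_funTS.
- by move=> x _; rewrite lee_fin.
rewrite integral_mkcond; apply: eq_integral => x _; rewrite patchE indicE.
by case: ifP => _; rewrite ?mulr1 ?mulr0 ?mul0e// EFinM.
Qed.

Lemma ge0_integral_density (f : T -> \bar R) :
  measurable_fun setT f -> (forall x, (0 <= f x)%E) ->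
  (\int[nu]_x f x = \int[la]_x (f x * (w x)%:E))%E.
Proof.
move=> mf f0; pose f_ := nnsfun_approx measurableT mf.
transitivity (limn (fun n => \int[nu]_x (f_ n x)%:E)%E).
  rewrite -monotone_convergence//=.
  - apply: eq_integral => x _; apply/esym/cvg_lim => //=.
    exact: cvg_nnsfun_approx.
  - by move=> n; exact/measurable_EFinP.
  - by move=> n x _; rewrite lee_fin.
  - by move=> x _ a b ab; rewrite lee_fin//; exact/lefP/nd_nnsfun_approx.
rewrite [RHS](_ : _ = limn (fun n => \int[la]_x ((f_ n x)%:E * (w x)%:E))%E); last first.
  rewrite -monotone_convergence//=.
  - apply: eq_integral => x _; apply/esym/cvg_lim => //.
    by apply: cvgeZr => //; exact: cvg_nnsfun_approx.
  - by move=> n; apply: emeasurable_funM; exact/measurable_EFinP.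
  - by move=> n x _; rewrite mule_ge0// lee_fin.
  - move=> x _ a b ab; rewrite lee_wpmul2r ?lee_fin//.
    exact/lefP/nd_nnsfun_approx.
by congr (limn _); apply/funext => n; exact: integral_density_nnsfun.
Qed.

End density.

(** * Random flights *)

Section clamped_displacement.
Context {R : realType} (d n : nat) (c t : R).
Hypotheses (c0 : 0 <= c) (t0 : 0 <= t).

(** Off the simplex all durations become 0, which leaves one segment of length t, so lengths are
    nonnegative with sum t everywhere. *)
Definition clamp_simplex (tau : Rvec R n) : Rvec R n :=
  [tuple (tnth tau k : R) * \1_(simplex t n) tau | k < n].

Lemma measurable_clamp_simplex : measurable_fun setT clamp_simplex.
Proof.
apply/measurable_fun_tnthP => i.
rewrite (_ : _ \o _ = fun v : Rvec R n => (tnth v i : R) * \1_(simplex t n) v).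
  apply: measurable_funM; first exact: measurable_tnth.
  by apply: measurable_indic; exact: measurable_simplex.
by apply/funext => v /=; rewrite tnth_mktuple.
Qed.

Lemma clamp_simplex_id tau : simplex t n tau -> clamp_simplex tau = tau.
Proof.
move=> st; apply: eq_from_tnth => k.
by rewrite tnth_mktuple indicE mem_set// mulr1.
Qed.

Lemma clamp_simplex_bounds tau :
  (forall k, 0 <= (tnth (clamp_simplex tau) k : R)) /\
  \sum_(k < n) (tnth (clamp_simplex tau) k : R) <= t.
Proof.
have [st|st] := pselect (simplex t n tau).
  rewrite clamp_simplex_id//; have [p0 s] := st.
  by split; [move=> k; exact: ltW|exact: ltW].
have E k : tnth (clamp_simplex tau) k = 0 :> R.
  by rewrite tnth_mktuple indicE memNset// mulr0.
by split=> [k|]; [rewrite E|rewrite big1].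
Qed.

Lemma clamp_simplex_ge0 tau : all (fun x : R => 0 <= x) (lengths t (clamp_simplex tau)).
Proof.
have [p0 s] := clamp_simplex_bounds tau.
rewrite all_rcons subr_ge0 s/=.
by apply/allP => x /(tnthP (clamp_simplex tau))[k ->].
Qed.

Definition clamped_displacement (z : n.+1.-tuple (Rvec R d) * Rvec R n) : Rvec R d :=
  displacement c t (fun k => clamp_sphere (tnth z.1 (inord k))) (clamp_simplex z.2).

Lemma tnth_lengths_widen (y : Rvec R n) (k : 'I_n) :
  tnth (lengths t y) (widen_ord (leqnSn n) k) = tnth y k.
Proof. by rewrite (tnth_nth 0) -[tval _]/(rcons _ _) nth_rcons size_tuple /= ltn_ord -tnth_nth. Qed.

Lemma tnth_lengths_max (y : Rvec R n) :
  tnth (lengths t y) ord_max = t - \sum_(k < n) (tnth y k : R).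
Proof. by rewrite (tnth_nth 0) -[tval _]/(rcons _ _) nth_rcons size_tuple ltnn eqxx. Qed.

Lemma displacementE (v : nat -> Rvec R d) (y : Rvec R n) i :
  tnth (displacement c t v y) i =
  c * \sum_(k < n.+1) (tnth (v k) i : R) * tnth (lengths t y) k :> R.
Proof.
rewrite tnth_mktuple big_ord_recr/= tnth_lengths_max; congr (_ * (_ + _)).
by apply: eq_bigr => k _; rewrite tnth_lengths_widen.
Qed.

Lemma clamped_displacement_le z i : `|tnth (clamped_displacement z) i : R| <= c * t.
Proof.
rewrite displacementE normrM ger0_norm// ler_wpM2l//.
have pos (k : 'I_n.+1) : 0 <= (tnth (lengths t (clamp_simplex z.2)) k : R).
  by have /all_tnthP := clamp_simplex_ge0 z.2; apply.
apply: (le_trans (ler_norm_sum _ _ _)).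
apply: (@le_trans _ _ (\sum_(k < n.+1) (tnth (lengths t (clamp_simplex z.2)) k : R))).
  apply: ler_sum => k _; rewrite normrM [X in _ * X]ger0_norm// ler_piMl//.
  exact: clamp_sphere_le1.
rewrite big_ord_recr/= tnth_lengths_max.
under eq_bigr do rewrite tnth_lengths_widen.
by rewrite subrKC.
Qed.

Lemma measurable_displacement d' (T : measurableType d') (v : nat -> T -> Rvec R d)
    (y : T -> Rvec R n) :
  (forall k, measurable_fun setT (v k)) -> measurable_fun setT y ->
  measurable_fun setT (fun z => displacement c t (fun k => v k z) (y z)).
Proof.
move=> mv my; apply/measurable_fun_tnthP => i.
rewrite (_ : _ \o _ = fun z => c * \sum_(k < n.+1) (tnth (v k z) i : R) *
    (tnth (lengths t (y z)) k : R)); last first.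
  by apply/funext => z /=; rewrite displacementE.
apply: measurable_funM => //; apply: measurable_sum => k; apply: measurable_funM.
  by apply: measurable_tnth_fun.
apply: measurable_tnth_fun; apply: measurableT_comp => //; exact: measurable_lengths.
Qed.

Lemma measurable_clamped_displacement : measurable_fun setT clamped_displacement.
Proof.
apply: measurable_displacement => [k|].
  apply: measurableT_comp; first exact: measurable_clamp_sphere.
  apply: (measurableT_comp (f := fun v : n.+1.-tuple (Rvec R d) => tnth v (inord k))) => //.
  exact: measurable_tnth.
by apply: measurableT_comp => //; exact: measurable_clamp_simplex.
Qed.

Lemma dot_clamped_displacement (xi : 'rV[R]_d) v y :
  \sum_(i < d) xi 0 i * (tnth (clamped_displacement (v, y)) i : R) =
  c * \sum_(k < n.+1) proj_sphere xi (tnth v k) * tnth (lengths t (clamp_simplex y)) k.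
Proof.
under eq_bigr do rewrite displacementE mulrCA big_distrr/=.
rewrite -big_distrr/=; congr (_ * _); rewrite exchange_big/=.
apply: eq_bigr => k _; rewrite /proj_sphere big_distrl/=; apply: eq_bigr => i _.
by rewrite inord_val mulrA.
Qed.

End clamped_displacement.

Section null_sets.
Context {R : realType} d (T : measurableType d) (mu : {measure set T -> \bar R}).

Lemma measure_eq_off_null (A B N : set T) : measurable A -> measurable B ->
  measurable N -> mu N = 0%E -> (forall x, ~ N x -> A x <-> B x) -> mu A = mu B.
Proof.
move=> mA mB mN N0 AB.
have offN (C : set T) : measurable C -> mu C = mu (C `\` N).
  move=> mC; have mI := measurableI _ _ mC mN; have mD := measurableD mC mN.
  have dis : C `&` N `&` (C `\` N) = set0 by apply/seteqP; split => // x [[_ ?] []].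
  have I0 : mu (C `&` N) = 0%E by apply: subset_measure0 N0 => //; exact: subIsetr.
  by rewrite -[in LHS](setUIDK C N) measureU// [X in (X + _)%E]I0 add0e.
rewrite (offN A)// (offN B)//; congr (mu _).
by apply/seteqP; split => x [Ax Nx]; split => //; apply/(AB x Nx).
Qed.

End null_sets.

(** Valid for infinite x too: [fine] sends infinities to 0, and 0 times infinity is 0. *)
Lemma fineZ {R : realType} (a : R) (x : \bar R) : fine (a%:E * x) = a * fine x.
Proof.
case: x => [x//| |]; rewrite [in RHS]/fine mulr0 mulr_infty.
  by case: (ltgtP a 0) => [/ltr0_sg->|/gtr0_sg->|->]; rewrite ?sgr0 ?mulN1e ?mul1e ?mul0e.
by case: (ltgtP a 0) => [/ltr0_sg->|/gtr0_sg->|->]; rewrite ?sgr0 ?mulN1e ?mul1e ?mul0e.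
Qed.

Section flight.
Context {R : realType} (d n : nat) (c t : R) (X : random_flight R d).
Hypotheses (c0 : 0 <= c) (t0 : 0 < t) (n1 : (1 <= n)%N) (d0 : (0 < d)%N).
Hypothesis unifX : uniform_flight X.
Hypothesis posE : (0 < flight_prob X (changes_eq X t n))%E.

Let P := flight_prob X.
Let E := changes_eq X t n.

Lemma measurable_changes_eq : measurable E.
Proof. by rewrite /E /changes_eq -[X in measurable X]setTI; apply: measurable_funP. Qed.

Lemma measurable_directions : measurable_fun setT (directions X n.+1).
Proof.
apply/measurable_fun_tnthP => k.
rewrite (_ : _ \o _ = direction X k); first exact: measurable_funP.
by apply/funext => w /=; rewrite tnth_mktuple.
Qed.

Let mdir := measurable_directions.
Let mdur : measurable_fun setT (duration X t n). Proof. exact: measurable_funP. Qed.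

Let Dirm : {mfun flight_space X >-> n.+1.-tuple (Rvec R d)} :=
  HB.pack (directions X n.+1) (isMeasurableFun.Build _ _ _ _ _ mdir).

Definition directions_law : probability (n.+1.-tuple (Rvec R d)) R := distribution P Dirm.
Definition duration_law : probability (Rvec R n) R := distribution P (duration X t n).

Let PE_fin : (fine (P E))%:E = P E.
Proof. by rewrite fineK// fin_num_measure//; exact: measurable_changes_eq. Qed.

Let PE_gt0 : 0 < fine (P E).
Proof. by rewrite -lte_fin PE_fin. Qed.

Lemma independent_given_changes A B : measurable A -> measurable B ->
  P (directions X n.+1 @^-1` A `&` duration X t n @^-1` B `&` E) =
  (directions_law A * duration_law B * P E)%E.
Proof.
by move=> mA mB; have [_ _ h] := unifX; rewrite (h t n t0 n1 A B [set n]).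
Qed.

Lemma cond_duration_lawE B : measurable B -> cond_duration_law X t n B = duration_law B.
Proof.
move=> mB; have := independent_given_changes measurableT mB.
rewrite preimage_setT setTI probability_setT mul1e => h.
rewrite /cond_duration_law /cond_prob h fineM//; last first.
- by rewrite fin_num_measure//; exact: measurable_changes_eq.
- by rewrite fin_num_measure.
by rewrite -mulrA mulfV ?mulr1 ?fineK ?fin_num_measure// gt_eqF.
Qed.

(** Conditionally on the event the two vectors are independent; uniqueness of the product measure
    extends this from rectangles to every C. *)
Lemma joint_law_given_changes C : measurable C ->
  ((directions_law \x duration_law) C * P E =
   P ((fun w => (directions X n.+1 w, duration X t n w)) @^-1` C `&` E))%E.
Proof.
move=> mC; pose W w := (directions X n.+1 w, duration X t n w).
have mW : measurable_fun setT W by apply/measurable_fun_pairP.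
have iPE : 0 <= (fine (P E))^-1 by rewrite invr_ge0 ltW.
pose q := mscale (NngNum iPE) (measure_function_pushforward__canonical__measure_function_Measure
   (mrestr P measurable_changes_eq) mW).
have PEV : ((fine (P E))^-1%:E * P E = 1)%E.
  by rewrite -PE_fin -EFinM mulVf// gt_eqF.
rewrite (@product_measure_unique _ _ _ _ _ _ _ q)//.
  rewrite /q/= /mscale/= /pushforward /mrestr [X in (X * _)%E]muleC -muleA PEV mule1.
  by [].
move=> A B mA mB; rewrite /q/= /mscale/= /pushforward /mrestr.
have -> : W @^-1` (A `*` B) = directions X n.+1 @^-1` A `&` duration X t n @^-1` B by [].
by rewrite independent_given_changes// muleC -muleA [X in (_ * X)%E]muleC PEV mule1.
Qed.

Hypothesis dur_simplex : duration_law (~` simplex t n) = 0%E.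

(** Given n changes, the position equals the clamped displacement unless a direction leaves the
    sphere or the durations leave the simplex, a null event. *)
Lemma cond_position_lawE A : measurable A ->
  cond_position_law c X t n A =
  (directions_law \x duration_law)%E (clamped_displacement c t @^-1` A).
Proof.
move=> mA; pose W w := (directions X n.+1 w, duration X t n w).
have mW : measurable_fun setT W by apply/measurable_fun_pairP.
have mZ := @measurable_clamped_displacement R d n c t.
have mZA : measurable (clamped_displacement (d := d) (n := n) c t @^-1` A).
  by rewrite -[X in measurable X]setTI; exact: mZ.
suff h : P (position c X t @^-1` A `&` E) = P (W @^-1` (clamped_displacement c t @^-1` A) `&` E).
  have f1 : (directions_law \x duration_law)%E (clamped_displacement c t @^-1` A) \is a fin_num.
    by apply: (fin_num_measure (directions_law \x duration_law : probability _ R)%E).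
  have f2 : P E \is a fin_num by rewrite fin_num_measure//; exact: measurable_changes_eq.
  have ne : fine (P E) != 0 by rewrite gt_eqF.
  rewrite -[LHS]/((fine (P (position c X t @^-1` A `&` E)) / fine (P E))%:E).
  rewrite h -joint_law_given_changes// fineM//.
  by rewrite -mulrA mulfV// mulr1 fineK.
pose F w := displacement c t (fun k => direction X k w) (duration X t n w).
have mF : measurable_fun setT F.
  by apply: measurable_displacement => // k; exact: measurable_funP.
have -> : position c X t @^-1` A `&` E = F @^-1` A `&` E.
  by apply/seteqP; split => w [/= + Ew]; rewrite /position (_ : changes X t w = n).
pose N := (\bigcup_k (direction X k @^-1` ~` unit_sphere d))
          `|` (duration X t n @^-1` ~` simplex t n).
have mS : measurable (~` unit_sphere d : set (Rvec R d)).
  by apply: measurableC; exact: measurable_unit_sphere.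
have mNk k : measurable (direction X k @^-1` ~` unit_sphere d).
  by rewrite -[X in measurable X]setTI; apply: measurable_funP.
have mNt : measurable (duration X t n @^-1` ~` simplex t n).
  rewrite -[X in measurable X]setTI; apply: mdur => //.
  by apply: measurableC; exact: measurable_simplex.
have mN1 : measurable (\bigcup_k (direction X k @^-1` ~` unit_sphere d)).
  exact: bigcupT_measurable.
apply: (@measure_eq_off_null _ _ _ P _ _ N).
- by apply: measurableI; [rewrite -[X in measurable X]setTI; exact: mF|exact: measurable_changes_eq].
- by apply: measurableI; [rewrite -[X in measurable X]setTI; exact: mW|exact: measurable_changes_eq].
- exact: measurableU.
- apply: null_set_setU => //.
  apply/negligibleP => //; apply: negligible_bigcup => k; apply/negligibleP => //.
  have [uk _ _] := unifX; have [sk _] := uk k.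
  rewrite -preimage_setC [LHS]probability_setC; last first.
    rewrite -[X in measurable X]setTI; apply: measurable_funP => //.
    exact: measurable_unit_sphere.
  by rewrite [X in (_ - X)%E]sk subee.
move=> w Nw; have Nk (k : 'I_n.+1) : unit_sphere d (direction X k w).
  by apply: contrapT => Sk; apply: Nw; left; exists k.
have Nt : simplex t n (duration X t n w).
  by apply: contrapT => St; apply: Nw; right.
suff FW : F w = clamped_displacement c t (W w).
  by split=> -[/= Aw Ew]; split => //=; [rewrite -FW|rewrite FW].
apply: eq_from_tnth => i; rewrite /clamped_displacement !displacementE clamp_simplex_id//.
congr (_ * _); apply: eq_bigr => k _; congr (_ * _).
by rewrite inord_val tnth_mktuple tnth_mktuple indicE mem_set ?mulr1.
Qed.


(** Fubini with the durations fixed: the projections of the directions are independent with moments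
    m. *)
Lemma position_moment (xi : 'rV[R]_d) (r : R) p :
  0 <= r -> (xi *m xi^T) 0 0 = r ^+ 2 ->
  let m q := r ^+ q * sphere_moment (d%:R / 2) q in
  \int[(directions_law \x duration_law)%E]_z
    ((\sum_(i < d) xi 0 i * (tnth (clamped_displacement c t z) i : R)) ^+ p) =
  c ^+ p * fine (\int[duration_law]_y (weighted_moment m (lengths t (clamp_simplex t y)) p)%:E)%E.
Proof.
move=> r0 xir m; have [uk iV _] := unifX.
have bZ : bounded_measurable (fun z : n.+1.-tuple (Rvec R d) * Rvec R n =>
    (\sum_(i < d) xi 0 i * (tnth (clamped_displacement c t z) i : R)) ^+ p).
  apply: bounded_measurableX; apply: bounded_measurable_sum => i.
  apply: bounded_measurableM; first exact: bounded_measurable_cst.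
  split; last by exists (c * t) => z; apply: clamped_displacement_le => //; exact: ltW.
  by apply: measurable_tnth_fun; exact: measurable_clamped_displacement.
have moments k q : \int[P]_w (proj_sphere xi (direction X k w) ^+ q) = m q.
  rewrite /m -(proj_moment (uk k) q d0 xir).
  have bf : bounded_measurable (fun v : Rvec R d => proj_sphere xi v ^+ q).
    by apply: bounded_measurableX; exact: bounded_measurable_proj.
  rewrite /Rintegral; congr fine.
  rewrite integral_pushforward//; first by apply/measurable_EFinP; have [] := bf.
  apply: (@bounded_measurable_integrable _ _ _ P (fun w => proj_sphere xi (direction X k w) ^+ q)).
  have [mf [B fB]] := bf; split; last by exists B => w.
  by apply: (measurableT_comp mf); exact: measurable_funP.
have inner y : \int[directions_law]_v
    ((\sum_(i < d) xi 0 i * (tnth (clamped_displacement c t (v, y)) i : R)) ^+ p) =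
    c ^+ p * weighted_moment m (lengths t (clamp_simplex t y)) p.
  have bS : bounded_measurable (fun v : n.+1.-tuple (Rvec R d) =>
      (\sum_(k < n.+1) proj_sphere xi (tnth v k) * tnth (lengths t (clamp_simplex t y)) k) ^+ p).
    apply: bounded_measurableX; apply: bounded_measurable_sum => k.
    apply: bounded_measurableM; last exact: bounded_measurable_cst.
    have [mf [B fB]] := bounded_measurable_proj xi; split; last by exists B => v.
    by apply: (measurableT_comp mf); exact: measurable_tnth.
  under eq_Rintegral do rewrite dot_clamped_displacement exprMn.
  rewrite RintegralZ_bounded//; congr (_ * _).
  rewrite -(@weighted_moment_mean _ _ _ P _ _ _ (fun k : 'I_n.+1 => direction X k : _ -> _)
    (proj_sphere xi) m (lengths t (clamp_simplex t y)) p)//; last exact: bounded_measurable_proj.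
  rewrite /Rintegral; congr fine.
  rewrite integral_pushforward//.
  - apply: eq_integral => w _ /=; congr (EFin (_ ^+ p)); apply: eq_bigr => k _.
    by rewrite tnth_mktuple.
  - by apply/measurable_EFinP; have [] := bS.
  - apply: (@bounded_measurable_integrable _ _ _ P (fun w =>
      (\sum_(k < n.+1) proj_sphere xi (tnth (directions X n.+1 w) k) * tnth (lengths t (clamp_simplex t y)) k) ^+ p)).
    have [mf [B fB]] := bS; split; last by exists B => w; exact: fB.
    exact: (measurableT_comp mf).
rewrite {1}/Rintegral -integral21_prod_meas1/=; last first.
  exact: (@bounded_measurable_integrable _ _ _ (directions_law \x duration_law : probability _ R)%E _ bZ).
under eq_integral.
  move=> y _; rewrite /fubini_G.
  have -> : (\int[directions_law]_v ((\sum_(i < d) xi 0 i * (tnth (clamped_displacement c t (v, y)) i : R)) ^+ p)%:E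
     = (c ^+ p)%:E * (weighted_moment m (lengths t (clamp_simplex t y)) p)%:E)%E.
    rewrite -EFinM -inner /Rintegral fineK//; apply: integrable_fin_num => //.
    apply: (@bounded_measurable_integrable _ _ _ directions_law (fun v =>
      (\sum_(i < d) xi 0 i * (tnth (clamped_displacement c t (v, y)) i : R)) ^+ p)).
    have [mf [B fB]] := bZ; split; last by exists B => v; exact: (fB (v, y)).
    apply: (measurableT_comp (g := fun v => (v, y)) mf).
    by apply/measurable_fun_pairP; split; [exact: measurable_id|exact: measurable_cst].
  over.
have mm : measurable_fun setT (fun y : Rvec R n => weighted_moment m (lengths t (clamp_simplex t y)) p).
  apply: (measurableT_comp (f := fun v : Rvec R n.+1 => weighted_moment m v p)).
    exact: measurable_weighted_moment.
  by apply: measurableT_comp; [exact: measurable_lengths|exact: measurable_clamp_simplex].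
have m0 y : 0 <= weighted_moment m (lengths t (clamp_simplex t y)) p.
  apply: weighted_moment_ge0; last by apply: clamp_simplex_ge0; exact: ltW.
  move=> q; rewrite mulr_ge0 ?exprn_ge0// sphere_moment_ge0//.
  by rewrite divr_gt0// ltr0n.
rewrite ge0_integralZl//; last 3 first.
- exact/measurable_EFinP.
- by move=> y _; rewrite lee_fin.
- by rewrite lee_fin exprn_ge0.
exact: fineZ.
Qed.

(** The indicator of the simplex goes into the density, and where it is nonzero clamping changes
    nothing. *)
Lemma duration_moment (K : R) a b (m : nat -> R) p :
  0 <= K -> (forall q, 0 <= m q) ->
  (forall A, measurable A -> duration_law A =
     (K%:E * \int[lebesgue_tuple n]_(tau in A `&` simplex t n) (GD_weight t a b tau)%:E)%E) ->
  (\int[duration_law]_y (weighted_moment m (lengths t (clamp_simplex t y)) p)%:E =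
   K%:E * GD_moment m t n a b p)%E.
Proof.
move=> K0 m0 lawE.
pose w tau : R := K * (GD_weight t a b tau * \1_(simplex t n) tau).
have mS := @measurable_simplex R t n.
have mw : measurable_fun setT w.
  apply: measurable_funM => //; apply: measurable_funM; first exact: measurable_GD_weight.
  exact: measurable_indic.
have w0 tau : 0 <= w tau by rewrite !mulr_ge0 ?GD_weight_ge0.
have mG : measurable_fun setT (@GD_weight R t n a b) by exact: measurable_GD_weight.
have dens A : measurable A -> (duration_law A = \int[lebesgue_tuple n]_(x in A) (w x)%:E)%E.
  move=> mA; have mAS := measurableI _ _ mA mS.
  rewrite lawE// -ge0_integralZl//; last 2 first.
  - by apply/measurable_EFinP; exact: measurable_funTS.
  - by move=> x _; rewrite lee_fin GD_weight_ge0.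
  rewrite integral_mkcondr; apply: eq_integral => x _; rewrite patchE /w indicE -EFinM.
  by case: ifP => _; rewrite ?mulr1 ?mulr0.
rewrite (ge0_integral_density mw w0 dens); last 2 first.
- apply/measurable_EFinP.
  apply: (measurableT_comp (f := fun v : Rvec R n.+1 => weighted_moment m v p)).
    exact: measurable_weighted_moment.
  by apply: measurableT_comp; [exact: measurable_lengths|exact: measurable_clamp_simplex].
- move=> y; rewrite lee_fin weighted_moment_ge0//.
  by apply: clamp_simplex_ge0; exact: ltW.
rewrite /GD_moment -ge0_integralZl//; last 2 first.
- exact: measurable_GD_integrand.
- by move=> y; apply: GD_integrand_ge0.
rewrite [RHS]integral_mkcond; apply: eq_integral => y _; rewrite patchE /w indicE.
case: ifPn => [|_]; last by rewrite !mulr0 mule0.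
by rewrite inE => st; rewrite clamp_simplex_id// mulr1 -!EFinM; congr EFin; ring.
Qed.

End flight.

Lemma weighted_moment0 {R : realType} (m : nat -> R) c : m 0%N = 1 -> weighted_moment m c 0 = 1.
Proof.
by move=> m1; elim: c => //= x c IH; rewrite big_ord_recl big_ord0 IH m1 bin0; ring.
Qed.

(** Total mass 1 forces the constant of a generalized Dirichlet law to be nonnegative and the
    integral of its weight to be finite. *)
Lemma mulEFin_eq1 {R : realType} (K : R) (x : \bar R) : (0 <= x)%E -> (K%:E * x = 1)%E ->
  0 <= K /\ x = (K^-1)%:E.
Proof.
case: x => [x|_ |//]; last first.
  rewrite mulr_infty; case: (ltgtP K 0) => [/ltr0_sg->|/gtr0_sg->|->];
    rewrite ?sgr0 ?mulN1e ?mul1e ?mul0e//.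
  by move=> [] /eqP; rewrite eq_sym oner_eq0.
rewrite lee_fin => x0; rewrite -EFinM => -[Kx].
have K0 : K != 0 by apply: contra_eq_neq Kx => ->; rewrite mul0r eq_sym oner_eq0.
have xE : x = K^-1 by rewrite -[LHS](mulKf K0) Kx mulr1.
by split; [rewrite -invr_ge0 -xE|rewrite xE].
Qed.

Section GD_flights.
Context {R : realType} (d j n : nat) (c t : R) (h i : bool) (X : random_flight R d).
Hypotheses (d3 : (3 <= d)%N) (c0 : 0 <= c) (t0 : 0 < t) (n1 : (1 <= n)%N).
Hypothesis GDX : GD_flight h i j X.
Hypothesis posE : (0 < flight_prob X (changes_eq X t n))%E.

Let a : nat -> R := GD_a (d := d) j n.
Let b : nat -> R := GD_b (d := d) h i j n.
Let moments (r : R) q := r ^+ q * sphere_moment (d%:R / 2) q.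

Lemma GD_flight_moments : exists K : R,
  [/\ forall r, (K%:E * GD_moment (moments r) t n a b 0 = 1)%E,
      (forall A, measurable A -> cond_position_law c X t n A =
        (directions_law n X \x duration_law n t X)%E (clamped_displacement c t @^-1` A)) &
      forall (xi : 'rV[R]_d) r p, 0 <= r -> (xi *m xi^T) 0 0 = r ^+ 2 ->
        \int[(directions_law n X \x duration_law n t X)%E]_z
          ((\sum_(l < d) xi 0 l * (tnth (clamped_displacement c t z) l : R)) ^+ p) =
        c ^+ p * fine (K%:E * GD_moment (moments r) t n a b p)%E].
Proof.
have d0 : (0 < d)%N by lia.
have [unifX dirX] := GDX.
have [mT [K muE]] := dirX t n t0 n1 posE.
have lawE A : measurable A -> duration_law n t X A =
    (K%:E * \int[lebesgue_tuple n]_(tau in A `&` simplex t n) (GD_weight t a b tau)%:E)%E.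
  by move=> mA; rewrite -(cond_duration_lawE t0 n1 unifX posE mA) muE.
have m0 r q : 0 <= r -> 0 <= moments r q.
  by move=> r0; rewrite mulr_ge0 ?exprn_ge0// sphere_moment_ge0// divr_gt0// ltr0n.
have norm r : (GD_moment (moments r) t n a b 0 = \int[lebesgue_tuple n]_(tau in simplex t n) (GD_weight t a b tau)%:E)%E.
  apply: eq_integral => tau _; rewrite weighted_moment0 ?mul1r//.
  by rewrite /moments /sphere_moment/= !poch0 expr0 divr1 mulr1.
have K1 r : (K%:E * GD_moment (moments r) t n a b 0 = 1)%E.
  by have := muE setT measurableT; rewrite mT setTI norm => <-.
have [K0 _] : 0 <= K /\ _ := mulEFin_eq1 (GD_moment_ge0 (fun q => m0 0 q (lexx 0)) t n a b 0) (K1 0).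
have ds : duration_law n t X (~` simplex t n) = 0%E.
  rewrite lawE; last by apply: measurableC; exact: measurable_simplex.
  by rewrite setICl integral_set0 mule0.
exists K; split=> // [A mA|xi r p r0 xir].
  exact: cond_position_lawE.
rewrite (position_moment n c0 t0 d0 unifX p r0 xir); congr (_ * fine _).
by apply: duration_moment => // q; exact: m0.
Qed.

End GD_flights.

Theorem theorem4 (R : realType) (d j : nat) (c : R)
    (X : bool -> bool -> random_flight R d) :
  (3 <= d)%N -> (1 <= j)%N -> 0 < c ->
  (forall h i : bool, GD_flight h i j (X h i)) ->
  forall (t : R) (n : nat), 0 < t -> (1 <= n)%N ->
  forall h i h' i' : bool,
    (0 < flight_prob (X h i) (changes_eq (X h i) t n))%E ->
    (0 < flight_prob (X h' i') (changes_eq (X h' i') t n))%E ->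
  forall A : set (Rvec R d), measurable A ->
    cond_position_law c (X h i) t n A = cond_position_law c (X h' i') t n A.
Proof.
move=> d3 j1 c_gt0 GDX t n t0 n1 h i h' i' pE pE' A mA.
have c0 : 0 <= c by exact: ltW.
have [K [K1 lawE mE]] := GD_flight_moments d3 c0 t0 n1 (GDX h i) pE.
have [K' [K1' lawE' mE']] := GD_flight_moments d3 c0 t0 n1 (GDX h' i') pE'.
rewrite lawE// lawE'//.
apply: (@bounded_moment_determinacy _ _ _ _ _ (directions_law n (X h i) \x duration_law n t (X h i) : probability _ R)%E
  (directions_law n (X h' i') \x duration_law n t (X h' i') : probability _ R)%E d (c * t)) => //.
- exact: measurable_clamped_displacement.
- exact: measurable_clamped_displacement.
- by move=> z l; apply: clamped_displacement_le => //; exact: ltW.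
- by move=> z l; apply: clamped_displacement_le => //; exact: ltW.
- by rewrite mulr_ge0// ltW.
move=> xi p; pose xi' : 'rV[R]_d := \row_l xi l.
have xiE d' (T : measurableType d') (P : {measure set T -> \bar R}) (Z : T -> Rvec R d) :
    \int[P]_z ((\sum_(l < d) xi l * (tnth (Z z) l : R)) ^+ p) =
    \int[P]_z ((\sum_(l < d) xi' 0 l * (tnth (Z z) l : R)) ^+ p).
  by apply: eq_Rintegral => z _; congr (_ ^+ _); apply: eq_bigr => l _; rewrite mxE.
rewrite !xiE; pose r := Num.sqrt ((xi' *m xi'^T) 0 0).
have r0 : 0 <= r by exact: sqrtr_ge0.
have xir : (xi' *m xi'^T) 0 0 = r ^+ 2.
  rewrite sqr_sqrtr// mxE; apply: sumr_ge0 => l _.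
  by rewrite [X in _ * X]mxE -expr2 sqr_ge0.
apply: (etrans (mE _ _ p r0 xir)); apply: (etrans _ (esym (mE' _ _ p r0 xir))); congr (_ * _).
(* For n <= j the parameters do not involve h and i, and both constants are inverses of the same
   total mass. *)
have [nj|jn] := leqP n j.
  have bE : GD_b (d := d) h i j n = GD_b (d := d) h' i' j n :> (nat -> R).
    by apply/funext => k; rewrite /GD_b nj.
  have m0 q : 0 <= r ^+ q * sphere_moment (d%:R / 2) q :> R.
    by rewrite mulr_ge0 ?exprn_ge0// sphere_moment_ge0// divr_gt0// ltr0n; lia.
  rewrite bE in K1 *; have J0 := GD_moment_ge0 m0 t n (GD_a (d := d) j n) (GD_b (d := d) h' i' j n) 0.
  have [_ E] := mulEFin_eq1 J0 (K1 r); have [_] := mulEFin_eq1 J0 (K1' r).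
  by rewrite E => -[/invr_inj ->].
have [y st] := GD_sphere_type r0 d3 j1 jn.
have [k [e kE]] := st h i; have [k' [e' kE']] := st h' i'.
have y1 : sphere_moment y 0 = 1 by rewrite /sphere_moment/= !poch0 divr1.
move: (K1 r) (K1' r); rewrite !kE// !kE'// -!EFinM /= y1 expr0 !mulr1 => -[E1] [E2].
(* By the moment of order 0, K k t^e = 1 = K' k' t^e', so both sides reduce to (r t)^p times the
   moment of parameter y. *)
transitivity (K * (k * t `^ e) * ((r * t) ^+ p * sphere_moment y p)); first by ring.
by rewrite E1 -E2; ring.
Qed.
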